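(* Let $r,d$ be positive integers and let $P=(P_1,\ldots,P_d):\mathbb{Z}^r \to \mathbb{Z}^d$ be an integer polynomial in $r$ variables with zero constant term such that the component polynomials $P_1,\ldots,P_d$ are linearly independent. Then for every $\delta>0$ and every $\varepsilon>0$ there exists a positive integer $k_0=k_0(P,\delta,\varepsilon)$ such that the following holds. For every ergodic measure preserving action $T$ of $\mathbb{Z}^d$ on a probability space $(X,\mu)$ and every measurable $A\subset X$ with $\mu(A)\geq \delta$ there exist a positive integer $k\leq k_0$ and a $T^k$-ergodic component $\nu$ of $\mu$ with $\nu(A)\geq \mu(A)$ satisfying \[ \nu\left( \bigcup_{n\in \mathbb{Z}^r} T^{P(n)}A \right) > 1-\varepsilon.\]
   Context: An integer polynomial is one whose components $P_i$ are polynomials with integer coefficients; linear independence is over $\mathbb{R}$ (equivalently over $\mathbb{Q}$). $T^k$-ergodic components: let $T$ be an ergodic measure preserving action of $\mathbb{Z}^d$ on $(X,\mu)$ and let $k$ be a positive integer. It is known that there are finitely many $k\mathbb{Z}^d$-invariant and $k\mathbb{Z}^d$-ergodic probability measures $\nu_1,\ldots,\nu_n$ with disjoint supports such that $\mu=\frac1n\sum_{i=1}^n\nu_i$, and each is of the form $\nu_i(\cdot)=\mu(\cdot\cap C_i)/\mu(C_i)$ for some $k\mathbb{Z}^d$-invariant set $C_i\subset X$. These $\nu_1,\ldots,\nu_n$ are called the $T^k$-ergodic components of $\mu$. *)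

(* Defs.v *)
From HB Require Import structures.
From mathcomp Require Import all_boot all_order all_algebra.
From mathcomp Require Import all_classical all_reals all_analysis.
From mathcomp Require mpoly.
(* The notations of mpoly clash with those of mathcomp-analysis. *)
Import -(notations) mpoly.

Set Implicit Arguments.
Unset Strict Implicit.
Unset Printing Implicit Defensive.

Import Order.TTheory GRing.Theory Num.Theory.
Import numFieldNormedType.Exports.

Local Open Scope classical_set_scope.
Local Open Scope ring_scope.

Section IntegerPolynomials.
Context (r d : nat).
Implicit Type P : 'I_d -> mpoly r int.

Definition zero_constant_term P : Prop :=
  forall i, mcoeff (mnm0 (n := r)) (P i) = 0.

Definition linearly_independent (R : realType) P : Prop :=
  forall c : 'I_d -> R,
    \sum_(i < d) c i *: map_mpoly (intr : int -> R) (P i) = 0 ->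
    forall i, c i = 0.

Definition poly_eval P (n : 'rV[int]_r) : 'rV[int]_d :=
  \row_(i < d) meval (fun j => n 0 j) (P i).

End IntegerPolynomials.

Definition group_action (d : nat) (X : Type) (T : 'rV[int]_d -> X -> X) : Prop :=
  (forall x, T 0 x = x) /\ (forall m n x, T (m + n) x = T m (T n x)).

(* T^k: the action of k Z^d, reparametrised as an action of Z^d. *)
Definition act_pow (d : nat) (X : Type) (T : 'rV[int]_d -> X -> X) (k : nat) :
    'rV[int]_d -> X -> X :=
  fun n => T (n *+ k).

Definition invariant_set (d : nat) (X : Type) (T : 'rV[int]_d -> X -> X)
    (C : set X) : Prop :=
  forall n, T n @^-1` C = C.

Section Ergodicity.
Context (disp : measure_display) (X : measurableType disp) (R : realType).
Context (d : nat).
Implicit Types (mu nu : probability X R) (T : 'rV[int]_d -> X -> X).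

Definition measure_preserving_action mu T : Prop :=
  [/\ group_action T,
      forall n, measurable_fun setT (T n) &
      forall n (B : set X), measurable B -> mu (T n @^-1` B) = mu B].

Definition ergodic_action mu T : Prop :=
  measure_preserving_action mu T /\
  forall C : set X, measurable C -> invariant_set T C ->
    mu C = 0%E \/ mu C = 1%E.

(* The measures nus i are carried by the sets C i, so the disjointness of the
   supports is expressed by the disjointness of the C i. *)
Definition ergodic_decomposition mu T (k m : nat)
    (nus : 'I_m -> probability X R) : Prop :=
  [/\ forall i, ergodic_action (nus i) (act_pow T k),
      forall B : set X, measurable B ->
        mu B = ((m%:R^-1)%:E * \sum_(i < m) nus i B)%E &
      exists C : 'I_m -> set X,
        trivIset setT C /\
        forall i,
          [/\ measurable (C i), invariant_set (act_pow T k) (C i),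
              (0 < mu (C i))%E &
              forall B : set X, measurable B ->
                nus i B = (mu (B `&` C i) / mu (C i))%E]].

Definition ergodic_component mu T (k : nat) nu : Prop :=
  exists (m : nat) (nus : 'I_m -> probability X R) (i : 'I_m),
    ergodic_decomposition mu T k nus /\ nu = nus i.

End Ergodicity.

(* Main.v *)
(* Write [a = nu A] for a component [nu] of [T^k] and let [phi x] be the
   correlation [nu (A /\ T^(k x) A) - a^2], a positive definite function on
   [Z^d].  If the average of [phi (p s - p s')] over a finite set of times is at
   most [e], Cauchy-Schwarz gives the complement of the union of the translates
   [T^(k p s) A] measure at most [e / a^2].  The substitution
   [t |-> (t, t^B, t^(B^2), ...)] turns [P] into a curve [p t = sum_i t^i v_i]
   whose coefficients span a finite-index subgroup of [Z^d], by linear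
   independence.

   By van der Corput differencing, averages along a polynomial are small as soon
   as [phi] has small mean along some bounded multiple of the leading
   coefficient.  Splitting off the part of [phi] invariant under a multiple of
   the leading coefficient, with the multiple chosen by pigeonhole on the mass of
   this part, reduces the degree; in the end only the mean of [phi] over
   [Q <v_1, ..., v_D>] remains, where [Q] depends on [D] and [e] alone.

   This mean is at most [eta] unless some component of [T^K], with [K] bounded in
   terms of [k], gives [A] a measure larger than [a + eta]: averaging
   [B |-> nu (B /\ T^(k x) A)] over the subgroup yields a [T^K]-invariant measure,
   hence a multiple of each component of [T^K].  Such a density increment can
   occur at most [1 / eta] times. *)
Require Import Defs.
From HB Require Import structures.
From mathcomp Require Import all_boot all_order all_algebra.
From mathcomp Require Import all_classical all_reals all_analysis.
From mathcomp Require mpoly.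
From mathcomp Require Import zify ring lra.
Import -(notations) mpoly.

Set Implicit Arguments.
Unset Strict Implicit.
Unset Printing Implicit Defensive.

Import Order.TTheory GRing.Theory Num.Theory.
Import numFieldNormedType.Exports.

Local Open Scope classical_set_scope.
Local Open Scope ring_scope.

(** * Averages and an invariant mean *)

Section Averages.
Context (R : realType).

Definition avg (I : Type) (s : seq I) (f : I -> R) : R :=
  (\sum_(i <- s) f i) / (size s)%:R.

Lemma eq_avg (I : Type) (s : seq I) (f g : I -> R) :
  f =1 g -> avg s f = avg s g.
Proof. by move=> fg; rewrite /avg (eq_bigr g). Qed.

Lemma eq_avg_in (I : eqType) (s : seq I) (f g : I -> R) :
  {in s, f =1 g} -> avg s f = avg s g.
Proof. by move=> fg; rewrite /avg; congr (_ / _); exact: eq_big_seq. Qed.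

Lemma avgD (I : Type) (s : seq I) (f g : I -> R) :
  avg s (fun i => f i + g i) = avg s f + avg s g.
Proof. by rewrite /avg big_split mulrDl. Qed.

Lemma avgZ (I : Type) (s : seq I) c (f : I -> R) :
  avg s (fun i => c * f i) = c * avg s f.
Proof. by rewrite /avg -big_distrr mulrA. Qed.

Lemma avgZr (I : Type) (s : seq I) c (f : I -> R) :
  avg s (fun i => f i * c) = avg s f * c.
Proof. by rewrite mulrC -avgZ; apply: eq_avg => i; rewrite mulrC. Qed.

Lemma avg_cst (I : Type) (s : seq I) c :
  (0 < size s)%N -> avg s (fun=> c) = c.
Proof.
move=> s0; rewrite /avg big_const_seq count_predT iter_addr_0 -[c *+ _]mulr_natr.
by rewrite mulfK// pnatr_eq0 -lt0n.
Qed.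

Lemma avg_le (I : eqType) (s : seq I) (f g : I -> R) :
  {in s, forall i, f i <= g i} -> avg s f <= avg s g.
Proof.
move=> fg; rewrite /avg ler_wpM2r ?invr_ge0//.
by rewrite big_seq [leRHS]big_seq; exact: ler_sum.
Qed.

Lemma avg_leT (I : Type) (s : seq I) (f g : I -> R) :
  (forall i, f i <= g i) -> avg s f <= avg s g.
Proof.
by move=> fg; rewrite /avg ler_wpM2r ?invr_ge0//; apply: ler_sum => i _.
Qed.

Lemma avg_ge0 (I : Type) (s : seq I) (f : I -> R) :
  (forall i, 0 <= f i) -> 0 <= avg s f.
Proof. by move=> f0; rewrite /avg divr_ge0// sumr_ge0. Qed.

Lemma avg_le_cst (I : eqType) (s : seq I) c (f : I -> R) : (0 < size s)%N ->
  {in s, forall i, f i <= c} -> avg s f <= c.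
Proof. by move=> s0 fc; rewrite -[leRHS](avg_cst c s0); exact: avg_le. Qed.

Lemma norm_avg_le (I : Type) (s : seq I) c (f : I -> R) : 0 <= c ->
  (forall i, `|f i| <= c) -> `|avg s f| <= c.
Proof.
move=> c0 fc; have [s0|s0] := posnP (size s).
  by rewrite /avg s0 invr0 mulr0 normr0.
rewrite /avg normrM normfV normr_nat// ler_pdivrMr ?ltr0n//.
rewrite (le_trans (ler_norm_sum _ _ _))// (le_trans (ler_sum _ (fun i _ => fc i)))//.
by rewrite big_const_seq count_predT iter_addr_0 mulr_natr.
Qed.

Lemma exchange_avg (I J : Type) (s : seq I) (t : seq J) (f : I -> J -> R) :
  avg s (fun i => avg t (f i)) = avg t (fun j => avg s (f^~ j)).
Proof.
rewrite /avg -!mulr_suml exchange_big/= -!mulrA; congr (_ * _).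
by rewrite mulrC.
Qed.

Lemma avg_allpairs (I J K : Type) (s : seq I) (t : seq J) (h : I -> J -> K)
    (f : K -> R) :
  avg [seq h i j | i <- s, j <- t] f = avg s (fun i => avg t (fun j => f (h i j))).
Proof.
rewrite /avg big_allpairs_dep/= -mulr_suml -mulrA -invfM -natrM.
by rewrite size_allpairs mulnC.
Qed.

Lemma avg_map (I J : Type) (s : seq I) (h : I -> J) (f : J -> R) :
  avg (map h s) f = avg s (f \o h).
Proof. by rewrite /avg big_map size_map. Qed.

End Averages.

Section InvariantMean.
Context (R : realType).

Definition bdd (I : Type) (f : I -> R) : Prop := exists C, forall x, `|f x| <= C.

Lemma bddD (I : Type) (f g : I -> R) : bdd f -> bdd g -> bdd (f \+ g).
Proof.
move=> [C fC] [D gD]; exists (C + D) => x.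
by rewrite (le_trans (ler_normD _ _))// lerD.
Qed.

Lemma bddZ (I : Type) c (f : I -> R) : bdd f -> bdd (fun x => c * f x).
Proof.
by move=> [C fC]; exists (`|c| * C) => x; rewrite normrM ler_wpM2l.
Qed.

Lemma bdd_cst (I : Type) c : bdd (fun _ : I => c).
Proof. by exists `|c|. Qed.

Lemma bdd_comp (I J : Type) (h : I -> J) (f : J -> R) : bdd f -> bdd (f \o h).
Proof. by move=> [C fC]; exists C => x; exact: fC. Qed.

Lemma bdd_sum (I J : Type) (s : seq J) (f : J -> I -> R) :
  (forall j, bdd (f j)) -> bdd (fun x => \sum_(j <- s) f j x).
Proof.
move=> bf; elim: s => [|j s IH].
  by exists 0 => x; rewrite big_nil normr0.
have [C HC] := bddD (bf j) IH; exists C => x; rewrite big_cons; exact: HC.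
Qed.

(* Averaging with Fejer weights, rather than over intervals, makes the mean of
   a positive definite function of [int] visibly nonnegative. *)
Definition fejer (N : nat) (f : int -> R) : R :=
  avg (iota 0 N.+1) (fun i => avg (iota 0 N.+1) (fun j => f (i%:Z - j%:Z))).

(** Along an ultrafilter finer than [\oo] every bounded sequence has a limit, so [mean] is a linear
    functional on all bounded functions. *)
Definition mean_filter : set_system nat := sval (cid (ultraFilterLemma eventually_filter)).

#[local] Instance mean_filter_ultra : UltraFilter mean_filter.
Proof. by rewrite /mean_filter; case: cid => U []. Qed.

Lemma eventually_mean_filter : \oo `<=` mean_filter.
Proof. by rewrite /mean_filter; case: cid => U []. Qed.

Definition mean (f : int -> R) : R := lim (fejer^~ f @ mean_filter).

Lemma norm_fejer_le N C (f : int -> R) : 0 <= C -> (forall t, `|f t| <= C) ->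
  `|fejer N f| <= C.
Proof. by move=> C0 fC; do 2![apply: norm_avg_le => // ?]. Qed.

(** The Fejer averages stay in a compact segment, hence cluster at some point, and an ultrafilter
    converges to each of its cluster points. *)
Lemma cvg_fejer f : bdd f -> fejer^~ f @ mean_filter --> mean f.
Proof.
move=> [C fC].
have C0 : 0 <= C by rewrite (le_trans _ (fC 0)).
have [|p [_ clp]] := @segment_compact R (- C) C (fejer^~ f @ mean_filter) _.
  apply: (@filterS _ mean_filter _ setT); last exact: filterT.
  by move=> N _ /=; rewrite in_itv/= -ler_norml; exact: norm_fejer_le.
suff cp : fejer^~ f @ mean_filter --> p by rewrite /mean (cvg_lim _ cp).
move=> V Vp; have [//|Vn] := in_ultra_setVsetC (fejer^~ f @^-1` V) mean_filter_ultra.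
by have [x [/= nVx Vx]] := clp (~` V) V Vn Vp.
Qed.

Lemma mean_ge0 f : bdd f -> (forall N, 0 <= fejer N f) -> 0 <= mean f.
Proof.
move=> bf f0; rewrite /mean; apply: limr_ge.
  by apply/cvg_ex; eexists; exact: cvg_fejer bf.
by apply: filterS filterT => N _; exact: f0.
Qed.

Lemma meanD f g : bdd f -> bdd g -> mean (f \+ g) = mean f + mean g.
Proof.
move=> bf bg; apply/cvg_lim => //.
rewrite (_ : fejer^~ _ = fejer^~ f \+ fejer^~ g); last first.
  apply/funext => N /=; rewrite /fejer -avgD.
  by apply: eq_avg => i; rewrite -avgD.
by apply: cvgD; exact: cvg_fejer.
Qed.

Lemma meanZ c f : bdd f -> mean (fun t => c * f t) = c * mean f.
Proof.
move=> bf; apply/cvg_lim => //.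
rewrite (_ : fejer^~ _ = (fun N => c * fejer N f)); last first.
  apply/funext => N /=; rewrite /fejer -avgZ.
  by apply: eq_avg => i; rewrite -avgZ.
by apply: cvgMr => //; exact: cvg_fejer.
Qed.

Lemma mean_cst c : mean (fun=> c) = c.
Proof.
apply/cvg_lim => //.
rewrite (_ : fejer^~ _ = fun=> c); first exact: cvg_cst.
by apply/funext => N /=; rewrite /fejer !avg_cst ?size_iota.
Qed.

Lemma mean_sum (J : Type) (s : seq J) (c : J -> R) (f : J -> int -> R) :
  (forall j, bdd (f j)) ->
  mean (fun t => \sum_(j <- s) c j * f j t) = \sum_(j <- s) c j * mean (f j).
Proof.
move=> bf; elim: s => [|j s IH].
  by rewrite big_nil -[RHS]mean_cst; congr mean; apply/funext => t; rewrite big_nil.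
rewrite big_cons -IH -meanZ// -meanD//.
- by congr mean; apply/funext => t /=; rewrite big_cons.
- exact: bddZ.
- by apply: bdd_sum => k; exact: bddZ.
Qed.

Lemma meanB f g : bdd f -> bdd g -> mean (fun t => f t - g t) = mean f - mean g.
Proof.
move=> bf bg; rewrite -[in RHS]mulN1r -meanZ// -meanD//; last exact: bddZ.
by congr mean; apply/funext => t /=; rewrite mulN1r.
Qed.

Lemma le_mean f g : bdd f -> bdd g -> (forall t, f t <= g t) -> mean f <= mean g.
Proof.
move=> bf bg fg; rewrite -subr_ge0 -meanB//; apply: mean_ge0 => [|N].
  by have := bddD bg (bddZ (-1) bf); congr bdd; apply/funext => t /=; rewrite mulN1r.
by do 2![apply: avg_ge0 => ?]; rewrite subr_ge0.
Qed.

Lemma mean_norm_le C f : (forall t, `|f t| <= C) -> `|mean f| <= C.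
Proof.
move=> fC; have bf : bdd f by exists C.
rewrite ler_norml -{2}(mean_cst C) -{1}(mean_cst (- C)) !le_mean//;
  by [exact: bdd_cst|move=> t; have := fC t; rewrite ler_norml => /andP[]].
Qed.

Lemma fejer_lt f a : bdd f -> mean f < a -> exists N, fejer N f < a.
Proof.
move=> bf fa.
have : \forall N \near mean_filter, fejer N f < a.
  by exact: (cvgr_lt _ (cvg_fejer bf)).
by move=> /filter_ex.
Qed.

(** For fixed [j] the inner sum telescopes to two boundary values, so the Fejer average of the
    difference is at most [2 * C / N.+1%:R]. *)
Lemma mean_shift1 f : bdd f -> mean (fun t => f (t + 1)) = mean f.
Proof.
move=> bf; apply/eqP; rewrite -subr_eq0 -meanB//; last exact: (bdd_comp (fun t => t + 1)).
apply/eqP/cvg_lim => //.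
have [C fC] := bf.
have fb N : `|fejer N (fun t => f (t + 1) - f t)| <= 2 * C / N.+1%:R.
  rewrite /fejer.
  rewrite exchange_avg; apply: norm_avg_le => [|j].
    by rewrite divr_ge0// mulr_ge0// (le_trans _ (fC 0)).
  rewrite /avg size_iota normrM normfV normr_nat ler_wpM2r ?invr_ge0//.
  have -> : \sum_(i <- iota 0 N.+1) (f (i%:Z - j%:Z + 1) - f (i%:Z - j%:Z)) =
            f (N.+1%:Z - j%:Z) - f (0%:Z - j%:Z).
    rewrite -[iota 0 N.+1]/(index_iota 0 N.+1) -(telescope_sumr (fun i : nat => f (i%:Z - j%:Z)) (leq0n N.+1)).
    apply: eq_bigr => i _; congr (f _ - _).
    by rewrite -addn1 PoszD addrAC.
  by rewrite (le_trans (ler_normB _ _))// mulr_natl mulr2n lerD.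
apply/cvgr0Pnorm_le => e e0.
apply: eventually_mean_filter.
have : (2 * C) / n.+1%:R @[n --> \oo] --> (2 * C * 0 : R).
  by apply: cvgMr => //; exact: cvg_harmonic.
rewrite mulr0 => /cvgr0Pnorm_le /(_ e e0); apply: filterS => N /=.
exact/le_trans/(le_trans (fb N))/ler_norm.
Qed.

Lemma mean_shift k f : bdd f -> mean (fun t => f (t + k)) = mean f.
Proof.
move=> bf.
have H (n : nat) g : bdd g -> mean (fun t => g (t + n%:Z)) = mean g.
  move=> bg; elim: n => [|n <-]; first by congr mean; apply/funext => t; rewrite addr0.
  rewrite -[RHS]mean_shift1; last exact: (bdd_comp (fun t => t + n%:Z)).
  by congr mean; apply/funext => t; rewrite -addrA -addn1 PoszD [1 + _]addrC.
case: k => n; first exact: H.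
rewrite -(H n.+1 (fun t => f (t + Negz n))); last exact: (bdd_comp (fun t => t + _)).
by congr mean; apply/funext => t; rewrite NegzE addrK.
Qed.

End InvariantMean.

(** * Positive definite functions *)

Section WeightedForm.
Context (R : realType) (I : Type) (K : I -> I -> R).
Implicit Types (s t : seq (R * I)).

(** A list of pairs (weight, point) stands for a finite linear combination; repeated points are
    allowed, so concatenation is addition. *)
Definition wform s t : R :=
  \sum_(a <- s) \sum_(b <- t) a.1 * b.1 * K a.2 b.2.

Lemma wform_catl s1 s2 t : wform (s1 ++ s2) t = wform s1 t + wform s2 t.
Proof. by rewrite /wform big_cat. Qed.

Lemma wform_catr s t1 t2 : wform s (t1 ++ t2) = wform s t1 + wform s t2.
Proof. by rewrite /wform -big_split; apply: eq_bigr => a _; rewrite big_cat. Qed.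

Lemma wform_sym s t : (forall x y, K x y = K y x) -> wform s t = wform t s.
Proof.
move=> sym; rewrite /wform exchange_big; apply: eq_bigr => a _; apply: eq_bigr => b _.
by rewrite sym [b.1 * _]mulrC.
Qed.

End WeightedForm.

Section PositiveDefinite.
Context (R : realType) (G : zmodType).
Implicit Types (phi psi : G -> R) (s t : seq (R * G)) (w : G).

Definition form phi s t : R := wform (fun x y => phi (x - y)) s t.

Definition posdef phi : Prop :=
  (forall x, phi (- x) = phi x) /\ forall s, 0 <= form phi s s.

Lemma formC phi s t : (forall x, phi (- x) = phi x) -> form phi s t = form phi t s.
Proof. by move=> sym; apply: wform_sym => x y; rewrite -sym opprB. Qed.

Lemma form_catl phi s1 s2 t : form phi (s1 ++ s2) t = form phi s1 t + form phi s2 t.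
Proof. exact: wform_catl. Qed.

Lemma form_catr phi s t1 t2 : form phi s (t1 ++ t2) = form phi s t1 + form phi s t2.
Proof. exact: wform_catr. Qed.

Definition wscale c s : seq (R * G) := [seq (c * a.1, a.2) | a <- s].

Definition wshift x s : seq (R * G) := [seq (a.1, x + a.2) | a <- s].

Lemma form_scalel phi c s t : form phi (wscale c s) t = c * form phi s t.
Proof.
rewrite /form /wform big_map mulr_sumr; apply: eq_bigr => a _.
by rewrite mulr_sumr; apply: eq_bigr => b _ /=; rewrite !mulrA.
Qed.

Lemma form_scaler phi c s t : form phi s (wscale c t) = c * form phi s t.
Proof.
rewrite /form /wform mulr_sumr; apply: eq_bigr => a _.
by rewrite big_map mulr_sumr; apply: eq_bigr => b _ /=; rewrite mulrCA !mulrA.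
Qed.

Lemma form_shift phi x y s t :
  form phi (wshift x s) (wshift y t) = form (fun z => phi (z + (x - y))) s t.
Proof.
rewrite /form /wform big_map; apply: eq_bigr => a _; rewrite big_map; apply: eq_bigr => b _ /=.
by congr (_ * phi _); rewrite opprD addrACA addrC.
Qed.

(** Expand the form at the combination [s - t], where it is nonnegative. *)
Lemma posdef_form_le phi s t : posdef phi ->
  2 * form phi s t <= form phi s s + form phi t t.
Proof.
move=> [sym pos]; have := pos (s ++ wscale (-1) t).
rewrite !(form_catl, form_catr, form_scalel, form_scaler) (formC t s)//; lra.
Qed.

Lemma posdefD phi psi : posdef phi -> posdef psi -> posdef (phi \+ psi).
Proof.
move=> [s1 p1] [s2 p2]; split=> [x|s]; first by rewrite /= s1 s2.
have := addr_ge0 (p1 s) (p2 s); congr (_ <= _); rewrite /form /wform -big_split.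
by apply: eq_bigr => a _; rewrite -big_split; apply: eq_bigr => b _; rewrite /= mulrDr.
Qed.

Lemma posdef0_ge0 phi : posdef phi -> 0 <= phi 0.
Proof.
move=> [_ /(_ [:: (1, 0)])].
by rewrite /form /wform !big_seq1 /= subr0 !mul1r.
Qed.

Lemma posdef_norm_le phi x : posdef phi -> `|phi x| <= phi 0.
Proof.
move=> pd; have H c : 2 * (c * phi x) <= c ^+ 2 * phi 0 + phi 0.
  have := posdef_form_le [:: (c, x)] [:: (1, 0)] pd.
  by rewrite /form /wform !big_seq1 /= !subrr subr0 !mul1r mulr1 expr2.
rewrite ler_norml; have := H 1; have := H (-1); rewrite sqrrN expr1n; lra.
Qed.

Lemma posdef_bdd phi : posdef phi -> bdd phi.
Proof. by move=> pd; exists (phi 0) => x; exact: posdef_norm_le. Qed.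

(** In the Hilbert space attached to a positive definite [phi], this is the squared norm of the
    average over [S] of the vectors indexed by [f i]. *)
Definition energy (phi : G -> R) (S : seq int) (f : int -> G) : R :=
  avg S (fun i => avg S (fun j => phi (f i - f j))).

Definition unif (I : Type) (S : seq I) (f : I -> G) : seq (R * G) :=
  [seq ((size S)%:R^-1, f i) | i <- S].

Lemma form_unif (I J : Type) phi (S : seq I) (T : seq J) f g :
  form phi (unif S f) (unif T g) = avg S (fun i => avg T (fun j => phi (f i - g j))).
Proof.
rewrite /form /wform big_map /avg mulr_suml; apply: eq_bigr => i _.
rewrite big_map mulrC mulr_suml mulr_sumr; apply: eq_bigr => j _ /=.
by rewrite -mulrA; congr (_ * _); rewrite mulrC.
Qed.

(** Multiplicities are kept, so that averages over a sumset are iterated averages. *)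
Definition sumset (S T : seq int) : seq int := [seq i + j | i <- S, j <- T].

Lemma size_sumset_gt0 S T :
  (0 < size S)%N -> (0 < size T)%N -> (0 < size (sumset S T))%N.
Proof. by move=> S0 T0; rewrite size_allpairs muln_gt0 S0. Qed.

Lemma avg_sumset S T (f : int -> R) :
  avg (sumset S T) f = avg S (fun i => avg T (fun j => f (i + j))).
Proof. exact: avg_allpairs. Qed.

Lemma sumsetC_energy phi S T f : energy phi (sumset S T) f = energy phi (sumset T S) f.
Proof.
have H (g : int -> R) : avg (sumset S T) g = avg (sumset T S) g.
  rewrite !avg_sumset exchange_avg; apply: eq_avg => i; apply: eq_avg => j.
  by rewrite addrC.
by rewrite /energy H; apply: eq_avg => i; rewrite H.
Qed.

(** Convexity of the squared norm: the average over the sumset is the average over [S] of the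
    averages over the translates [i + T]. *)
Lemma energy_sumset_le phi S T f : posdef phi -> (0 < size S)%N ->
  energy phi (sumset S T) f <= avg S (fun i => energy phi T (fun j => f (i + j))).
Proof.
move=> pd S0; rewrite /energy avg_sumset.
pose k i := unif T (fun j => f (i + j)).
have kE i i' : form phi (k i) (k i') =
  avg T (fun j => avg T (fun j' => phi (f (i + j) - f (i' + j')))) by rewrite form_unif.
rewrite [leRHS](_ : _ = avg S (fun i => form phi (k i) (k i))); last first.
  by apply: eq_avg => i; rewrite kE.
rewrite [leLHS](_ : _ = avg S (fun i => avg S (fun i' => form phi (k i) (k i')))); last first.
  apply: eq_avg => i; rewrite (eq_avg _ (kE i)) [RHS]exchange_avg.
  by apply: eq_avg => j; rewrite avg_sumset.
set F := fun i => form phi (k i) (k i).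
(* The right-hand side is symmetrized into a double average, to be compared termwise through
   [2 <u, v> <= |u|^2 + |v|^2]. *)
rewrite [leRHS](_ : _ = avg S (fun i => avg S (fun i' => (F i + F i') / 2))); last first.
  transitivity (avg S (fun i => (F i + avg S F) / 2)).
    by rewrite avgZr avgD avg_cst//; lra.
  by apply: eq_avg => i; rewrite avgZr avgD avg_cst.
apply: avg_leT => i; apply: avg_leT => i'.
have := posdef_form_le (k i) (k i') pd; rewrite /F; lra.
Qed.

(** Cauchy-Schwarz against the point mass at 0, in additive form with a free weight [l]. *)
Lemma avg_posdef_le phi S f (l : R) : posdef phi -> 0 < l ->
  avg S (fun i => phi (f i)) <= (energy phi S f / l + l * phi 0) / 2.
Proof.
move=> pd l0.
have := posdef_form_le (unif S f) (wscale l [:: (1, 0)]) pd.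
rewrite !(form_scalel, form_scaler) !form_unif -/(energy phi S f).
rewrite (_ : form phi (unif S f) _ = avg S (fun i => phi (f i))); last first.
  rewrite /form /wform big_map /avg mulr_suml; apply: eq_bigr => i _.
  by rewrite big_seq1 /= mulr1 subr0 mulrC.
rewrite /form /wform !big_seq1 /= subr0 !mul1r => h.
rewrite -subr_ge0.
have -> : (energy phi S f / l + l * phi 0) / 2 - avg S (fun i => phi (f i)) =
  (energy phi S f + l * (l * phi 0) - 2 * (l * avg S (fun i => phi (f i)))) / (2 * l).
  by field; lra.
by rewrite divr_ge0 ?subr_ge0//; lra.
Qed.

(* The spectral measure of [phi] restricted to the characters trivial on [w];
   averages over the multiples of [w], as an orthogonal projection would. *)
Definition proj w phi : G -> R := fun x => mean (fun t : int => phi (x + w *~ t)).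

Lemma proj_bdd w phi : bdd phi -> bdd (proj w phi).
Proof. by move=> [C fC]; exists C => x; exact: mean_norm_le. Qed.

Lemma bdd_line w x phi : bdd phi -> bdd (fun t : int => phi (x + w *~ t)).
Proof. exact: (bdd_comp (fun t : int => x + w *~ t)). Qed.

Lemma proj_line w x phi k : bdd phi -> proj w phi (x + w *~ k) = proj w phi x.
Proof.
move=> bp; rewrite /proj -[RHS](mean_shift k); last exact: bdd_line.
by congr mean; apply/funext => t; rewrite mulrzDr addrAC addrA.
Qed.

Lemma proj_translate w x y phi :
  proj w phi (x + y) = proj w (fun z => phi (z + y)) x.
Proof. by rewrite /proj; congr mean; apply/funext => t; rewrite addrAC. Qed.

Definition invariant w phi : Prop := forall x, phi (x + w) = phi x.

Lemma invariant_mulz w phi k x : invariant w phi -> phi (x + w *~ k) = phi x.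
Proof.
move=> inv; have H (n : nat) y : phi (y + w *+ n) = phi y.
  by elim: n y => [|n IH] y; rewrite ?mulr0n ?addr0// mulrS addrA IH inv.
case: k => n; first by rewrite -pmulrn H.
by rewrite NegzE mulrNz -pmulrn -[in RHS](subrK (w *+ n.+1) x) H.
Qed.

Lemma invariantMz w phi k : invariant w phi -> invariant (w *~ k) phi.
Proof. by move=> inv x; exact: invariant_mulz. Qed.

Lemma invariantD w w' phi : invariant w phi -> invariant w' phi -> invariant (w + w') phi.
Proof. by move=> i i' x; rewrite addrA i' i. Qed.

Lemma proj_invariant w phi : bdd phi -> invariant w (proj w phi).
Proof. by move=> bp x; rewrite -(proj_line w x 1 bp) mulr1z. Qed.

Lemma proj_invariantW w w' phi : invariant w' phi -> invariant w' (proj w phi).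
Proof.
by move=> inv x; rewrite /proj; congr mean; apply/funext => t; rewrite addrAC inv.
Qed.

Lemma invariant_proj w phi : invariant w phi -> proj w phi = phi.
Proof.
move=> inv; apply/funext => x; rewrite /proj -[RHS]mean_cst.
by congr mean; apply/funext => t; rewrite invariant_mulz.
Qed.

Lemma form_proj w phi s t : bdd phi ->
  form (proj w phi) s t = mean (fun k : int => form (fun z => phi (z + w *~ k)) s t).
Proof.
move=> bp; rewrite /form.
rewrite (_ : (fun k : int => _) = (fun k : int => \sum_(a <- s) 1 *
    \sum_(b <- t) a.1 * b.1 * phi (a.2 - b.2 + w *~ k))); last first.
  by apply/funext => k; apply: eq_bigr => a _; rewrite mul1r.
rewrite mean_sum; last first.
  by move=> a; apply: bdd_sum => b; apply: bddZ; exact: (bdd_line w _ bp).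
apply: eq_bigr => a _; rewrite mul1r mean_sum// => b; exact: (bdd_line w _ bp).
Qed.

Lemma bdd_form phi s t : bdd phi ->
  forall w, bdd (fun k : int => form (fun z => phi (z + w *~ k)) s t).
Proof.
move=> bp w; apply: bdd_sum => a; apply: bdd_sum => b; apply: bddZ.
exact: (bdd_line w _ bp).
Qed.

(** Each Fejer average of the translated forms is the form of [phi] at the average of the translates
    of [s] by [w *+ i], hence nonnegative. *)
Lemma proj_posdef w phi : posdef phi -> posdef (proj w phi).
Proof.
move=> pd; have bp := posdef_bdd pd; have [sym pos] := pd; split => [x|s].
  (* Exchanging the two Fejer indices reverses the sign of their difference, so [mean] is invariant
     under reflection. *)
  have H (g : int -> R) : mean g = mean (fun t : int => g (- t)).
    rewrite /mean; suff -> : (fun N => fejer N g) = (fun N => fejer N (fun t : int => g (- t))) by [].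
    apply/funext => N; rewrite /fejer exchange_avg.
    by apply: eq_avg => i; apply: eq_avg => j; rewrite opprB.
  rewrite /proj H; congr mean; apply/funext => t.
  by rewrite -sym opprD opprK mulrNz opprK.
rewrite form_proj//; apply: mean_ge0 => [|N]; first exact: bdd_form.
rewrite (_ : fejer _ _ = form phi
  (flatten [seq wscale (N.+1%:R^-1) (wshift (w *+ i) s) | i <- iota 0 N.+1])
  (flatten [seq wscale (N.+1%:R^-1) (wshift (w *+ i) s) | i <- iota 0 N.+1])) //.
have H (I J : Type) (r : seq I) (r' : seq J) (u : I -> seq (R * G)) v :
    form phi (flatten [seq u i | i <- r]) (flatten [seq v j | j <- r']) =
    \sum_(i <- r) \sum_(j <- r') form phi (u i) (v j).
  elim: r => [|i r IH] /=; first by rewrite /form /wform !big_nil.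
  rewrite form_catl big_cons IH; congr (_ + _).
  elim: r' {IH} => [|j r' IH] /=.
    by rewrite /form /wform big_nil; apply: big1 => a _; rewrite big_nil.
  by rewrite form_catr big_cons IH.
rewrite H /fejer /avg mulr_suml; apply: eq_bigr => i _.
rewrite size_iota mulr_suml mulr_suml; apply: eq_bigr => j _.
rewrite form_scalel form_scaler form_shift mulrC; congr (_ * _).
rewrite mulrC; congr (_ * _).
by congr form; apply/funext => z; congr (phi (_ + _)); rewrite mulrzBr -!pmulrn.
Qed.

(** The form of [proj w phi] at [s] is the mean over [k] of the inner products of [s] with its
    translate by [w *~ k]; each is at most the squared norm of [s]. *)
Lemma proj_compl_posdef w phi : posdef phi -> posdef (fun x => phi x - proj w phi x).
Proof.
move=> pd; have bp := posdef_bdd pd; have [sym pos] := pd; split => [x|s].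
  by rewrite sym (proj_posdef w pd).1.
rewrite (_ : form _ s s = form phi s s - form (proj w phi) s s); last first.
  rewrite /form /wform -sumrB; apply: eq_bigr => a _; rewrite -sumrB; apply: eq_bigr => b _.
  by rewrite mulrBr.
rewrite subr_ge0 form_proj// -[leRHS]mean_cst; apply: le_mean => [||k].
- exact: bdd_form.
- exact: bdd_cst.
have := posdef_form_le (wshift (w *~ k) s) s pd.
have wshift0 : s = wshift 0 s.
  by rewrite /wshift -[LHS]map_id; apply: eq_map => -[a b]; rewrite add0r.
rewrite {2}wshift0 !form_shift subr0 subrr.
have -> : (fun z => phi (z + 0)) = phi by apply/funext => z; rewrite addr0.
lra.
Qed.

Lemma projB w phi psi : bdd phi -> bdd psi ->
  proj w (fun x => phi x - psi x) = (fun x => proj w phi x - proj w psi x).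
Proof.
by move=> bp bq; apply/funext => x; rewrite /proj -meanB//; exact: bdd_line.
Qed.

(** For positive definite functions this is domination of the spectral measures. *)
Definition pdle phi psi : Prop := posdef (fun x => psi x - phi x).

Lemma pdle_trans phi psi chi : pdle phi psi -> pdle psi chi -> pdle phi chi.
Proof.
move=> h1 h2; have := posdefD h1 h2; congr posdef; apply/funext => x /=.
by rewrite addrC addrA subrK.
Qed.

Lemma pdle0 phi psi : pdle phi psi -> phi 0 <= psi 0.
Proof. by move=> /posdef0_ge0; rewrite subr_ge0. Qed.

Lemma proj_le w phi psi : bdd phi -> bdd psi -> pdle phi psi ->
  pdle (proj w phi) (proj w psi).
Proof. by move=> bp bq /(proj_posdef w); rewrite projB. Qed.

(** Apply [proj (w *~ k)] to the positive definite function [phi - proj w phi], whose second term is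
    already invariant under [w *~ k]. *)
Lemma proj_mulz_le w k phi : posdef phi -> pdle (proj w phi) (proj (w *~ k) phi).
Proof.
move=> pd; have bp := posdef_bdd pd; have bE := proj_bdd w bp.
have := proj_posdef (w *~ k) (proj_compl_posdef w pd).
rewrite projB// (@invariant_proj _ (proj w phi))//.
exact/invariantMz/proj_invariant.
Qed.

(** The iterated mean along the vectors of [vs] is an invariant mean over the subgroup they
    generate. *)
Definition projs (vs : seq G) phi : G -> R := foldr proj phi vs.

Lemma projs_posdef vs phi : posdef phi -> posdef (projs vs phi).
Proof. by move=> pd; elim: vs => //= v vs; exact: proj_posdef. Qed.

Lemma projs_bdd vs phi : bdd phi -> bdd (projs vs phi).
Proof. by move=> pd; elim: vs => //= v vs; exact: proj_bdd. Qed.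

Lemma projs_le vs phi psi : bdd phi -> bdd psi -> pdle phi psi ->
  pdle (projs vs phi) (projs vs psi).
Proof.
move=> bp bq h; elim: vs => //= v vs; apply: proj_le; exact: projs_bdd.
Qed.

Lemma projs_mulz_le vs (k l : int) phi : posdef phi ->
  pdle (projs [seq v *~ k | v <- vs] phi) (projs [seq v *~ (k * l) | v <- vs] phi).
Proof.
move=> pd; elim: vs => [|v vs IH] /=.
  split=> [x|s]; first by rewrite !subrr.
  by apply: sumr_ge0 => a _; apply: sumr_ge0 => b _; rewrite subrr mulr0.
apply: (pdle_trans (psi := proj (v *~ k) (projs [seq v *~ (k * l) | v <- vs] phi))).
  by apply: proj_le IH; apply: projs_bdd; exact: posdef_bdd.
by rewrite mulrzA; apply: proj_mulz_le; exact: projs_posdef.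
Qed.

Lemma projs_translate vs phi y x :
  projs vs phi (x + y) = projs vs (fun z => phi (z + y)) x.
Proof.
suff : (fun z => projs vs phi (z + y)) = projs vs (fun z => phi (z + y)).
  by move=> /(congr1 (@^~ x)).
elim: vs => //= v vs IH; rewrite -IH; apply/funext => z; exact: proj_translate.
Qed.

Lemma le_projs vs phi psi : bdd phi -> bdd psi -> (forall x, phi x <= psi x) ->
  forall x, projs vs phi x <= projs vs psi x.
Proof.
move=> bp bq h; elim: vs => //= v vs IH x.
by apply: le_mean => [||t]; [exact/bdd_line/projs_bdd|exact/bdd_line/projs_bdd|exact: IH].
Qed.

Lemma projs_cst vs (r : R) x : projs vs (fun=> r) x = r.
Proof.
suff -> : projs vs (fun=> r) = (fun=> r) by [].
by elim: vs => //= v vs ->; apply/funext => y; exact: mean_cst.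
Qed.

Lemma projsD vs phi psi x : bdd phi -> bdd psi ->
  projs vs (fun z => phi z + psi z) x = projs vs phi x + projs vs psi x.
Proof.
move=> bp bq; elim: vs x => //= v vs IH x; rewrite /proj -meanD.
- by congr mean; apply/funext => t; exact: IH.
- exact/bdd_line/projs_bdd.
- exact/bdd_line/projs_bdd.
Qed.

Lemma invariant0 phi : invariant 0 phi.
Proof. by move=> x; rewrite addr0. Qed.

Lemma projs_invariant vs phi v : bdd phi -> v \in vs -> invariant v (projs vs phi).
Proof.
move=> bp; elim: vs => //= w vs IH; rewrite in_cons => /orP[/eqP ->|/IH inv].
  by apply: proj_invariant; exact: projs_bdd.
exact: proj_invariantW.
Qed.

End PositiveDefinite.

(** * Van der Corput differencing *)

Section Leading.
Context (G : zmodType).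
Implicit Types (u v : G) (f g : int -> G).

(* [lead D u f] holds for a polynomial map [f] of degree at most [D] whose
   coefficient of degree [D] is [u / D`!]. *)
Fixpoint lead (D : nat) u f : Prop :=
  if D is D'.+1 then forall h, lead D' (u *~ h) (fun t => f (t + h) - f t)
  else forall t, f t = u.

Lemma lead_shift D u f c : lead D u f -> lead D u (fun t => f (t + c)).
Proof.
elim: D u f => [|D IH] u f /= uf; first by move=> t; exact: uf.
move=> h; have := IH _ _ (uf h); congr lead; apply/funext => t.
by rewrite addrAC.
Qed.

Lemma leadD D u v f g : lead D u f -> lead D v g -> lead D (u + v) (f \+ g).
Proof.
elim: D u v f g => [|D IH] u v f g /= uf vg; first by move=> t /=; rewrite uf vg.
move=> h; rewrite mulrzDl; have := IH _ _ _ _ (uf h) (vg h).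
by congr lead; apply/funext => t /=; rewrite opprD addrACA.
Qed.

Lemma lead0 D : lead D 0 (fun=> 0).
Proof.
elim: D => [|D IH] //= h; rewrite mul0rz.
by move: IH; congr lead; apply/funext => t; rewrite subrr.
Qed.

Lemma leadW D u f : lead D u f -> lead D.+1 0 f.
Proof.
elim: D u f => [|D IH] u f uf h.
  by rewrite mul0rz /= => t; rewrite !uf subrr.
by rewrite mul0rz; exact: IH (uf h).
Qed.

Lemma lead_diff D u f h h' : lead D.+1 u f ->
  lead D (u *~ (h - h')) (fun t => f (t + h) - f (t + h')).
Proof.
move=> /(_ (h - h')) /(lead_shift h'); congr lead; apply/funext => t.
by congr (f _ - _); ring.
Qed.

End Leading.

Lemma lead_mulz (G : zmodType) (v : G) D (a : int) (f : int -> int) :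
  lead D a f -> lead D (v *~ a) (fun t => v *~ f t).
Proof.
elim: D a f => [|D IH] a f /= af; first by move=> t; rewrite af.
move=> h; have := IH _ _ (af h); rewrite -mulrzA mulrzz.
by congr lead; apply/funext => t; rewrite mulrzBr.
Qed.

(** The constants are arbitrary so that induction applies: differencing a product of affine factors
    of slope [q] gives a sum of shorter such products, with other constants. *)
Lemma lead_prod (q : int) (cs : seq int) :
  lead (size cs) ((size cs)`!%:Z * q ^+ size cs) (fun t => \prod_(c <- cs) (c + q * t)).
Proof.
pose pr (l : seq int) t := \prod_(c <- l) (c + q * t).
(* Discrete product rule: each term omits one factor and shifts the constants of the factors after
   it. *)
have diff (l : seq int) h : exists2 ls : seq (seq int),
    size ls = size l /\ (forall l', l' \in ls -> (size l').+1 = size l) &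
    forall t, pr l (t + h) - pr l t = \sum_(l' <- ls) q * h * pr l' t.
  elim: l => [|c l [ls [sls lsl] E]].
    by exists [::] => // t; rewrite /pr !big_nil subrr.
  exists (map (fun c => c + q * h) l :: [seq c :: l' | l' <- ls]).
    split=> [|l' /=]; first by rewrite /= size_map sls.
    rewrite in_cons => /orP[/eqP ->|/mapP[l'' /lsl /= <- ->//]].
    by rewrite size_map.
  move=> t; rewrite big_cons big_map.
  have -> : pr (map (fun c => c + q * h) l) t = pr l (t + h).
    by rewrite /pr big_map; apply: eq_bigr => x _; ring.
  have -> : \sum_(l' <- ls) q * h * pr (c :: l') t = (c + q * t) * (pr l (t + h) - pr l t).
    rewrite E mulr_sumr; apply: eq_bigr => l' _; rewrite /pr big_cons; ring.
  rewrite /pr !big_cons; ring.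
have [n] := ubnP (size cs); elim: n cs => // n IH [|c cs] /=.
  by move=> _ t; rewrite big_nil.
rewrite ltnS => csn h.
have [ls [sls lsl] E] := diff (c :: cs) h.
rewrite (_ : (fun t => _) = (fun t => \sum_(l' <- ls) q * h * pr l' t)); last first.
  by apply/funext => t; exact: E.
rewrite (_ : _ *~ h = (size ls)%:Z * (q * h * ((size cs)`!%:Z * q ^+ size cs))); last first.
  by rewrite sls /= factS PoszM mulrzz exprS; ring.
elim: ls {sls E} lsl => [|l' ls IHls] lsl.
  rewrite mul0r; have := lead0 int (size cs); congr lead.
  by apply/funext => t; rewrite big_nil.
rewrite (_ : (fun t => _) =
  (fun t => q * h * pr l' t) \+ (fun t => \sum_(l' <- ls) q * h * pr l' t)); last first.
  by apply/funext => t; rewrite big_cons.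
rewrite -[(size _)%:Z]/((size ls).+1%:Z) -addn1 PoszD mulrDl mul1r addrC.
apply: leadD; last by apply: IHls => l'' h''; apply: lsl; rewrite in_cons h'' orbT.
have /eqP := lsl l' (mem_head _ _); rewrite eqSS => /eqP szl.
have := IH l'; rewrite szl => /(_ csn) /(lead_mulz (q * h)).
by rewrite mulrzz; congr lead; apply/funext => t; rewrite mulrzz.
Qed.

Section VanDerCorput.
Context (R : realType).

(** The order of quantifiers matters: [S] must not depend on the lower-order terms of [f]. *)
Definition good (G : zmodType) (eps : R) D (u : G) (psi : G -> R) (S : seq int) :=
  (0 < size S)%N /\ forall f, lead D u f -> energy psi S f <= eps.

Lemma good_sumset (G : zmodType) eps D (u : G) psi S T : posdef psi ->
  (0 < size T)%N -> good eps D u psi S -> good eps D u psi (sumset T S).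
Proof.
move=> pd T0 [S0 gS]; split=> [|f uf]; first exact: size_sumset_gt0.
rewrite (le_trans (energy_sumset_le _ _ _ _))//; apply: avg_le_cst => // i _.
apply: gS; have := lead_shift i uf; congr lead; apply/funext => t.
by rewrite addrC.
Qed.

(** Take successive sumsets: translating the argument preserves the leading coefficient, so adding
    further times keeps a good set good. *)
Lemma good_common (G : zmodType) eps D (us : seq G) psi : posdef psi ->
  {in us, forall u, exists S, good eps D u psi S} ->
  exists2 S, (0 < size S)%N & {in us, forall u, good eps D u psi S}.
Proof.
move=> pd; elim: us => [|u us IH] gus; first by exists [:: 0].
have [S S0 gS] := IH (fun v vus => gus v (mem_behead (s := u :: us) vus)).
have [T gT] := gus u (mem_head _ _).
exists (sumset T S); first by apply: size_sumset_gt0 => //; case: gT.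
move=> v; rewrite in_cons => /orP[/eqP ->|vus].
  split=> [|f uf]; first by apply: size_sumset_gt0 => //; case: gT.
  by rewrite sumsetC_energy; apply: (good_sumset pd S0 gT).2.
by apply: good_sumset (gS v vus) => //; case: gT.
Qed.

Lemma avg_pair_eq_le (T : seq int) (c e : R) : uniq T -> (0 < size T)%N ->
  avg T (fun i => avg T (fun j => (i == j)%:R * c + e)) = c / (size T)%:R + e.
Proof.
move=> uT T0.
transitivity (avg T (fun=> c / (size T)%:R + e)); last by rewrite avg_cst.
apply: eq_avg_in => i iT.
rewrite avgD avg_cst// avgZr; congr (_ + _); rewrite mulrC; congr (_ * _).
rewrite /avg (bigD1_seq i)//= eqxx big1 ?addr0 ?div1r// => j.
by rewrite eq_sym => /negPf ->.
Qed.

(** Induction on the degree: averaging over an interval [T] of shifts leads to the differences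
    [f (t + h) - f (t + h')], of lower degree with leading coefficient [u *~ (h - h')]. In degree 1
    the energy over an interval is itself a Fejer average of [psi] along [u]. *)
Lemma van_der_corput D (eps : R) : 0 < eps ->
  exists (q : nat) (eta : R), [/\ (0 < q)%N, 0 < eta &
    forall (G : zmodType) (psi : G -> R) u, posdef psi -> psi 0 <= 1 ->
      proj (u *~ q) psi 0 < eta -> exists S, good eps D.+1 u psi S].
Proof.
elim: D eps => [|D IH] eps e0.
  exists 1%N, eps; split => // G psi u pd _.
  move=> /(fejer_lt (bdd_line _ _ (posdef_bdd pd))) [N fN].
  exists (map Posz (iota 0 N.+1)); split; first by rewrite size_map size_iota.
  move=> f uf; apply: le_trans (ltW fN).
  rewrite /energy avg_map le_eqVlt; apply/orP; left; apply/eqP/eq_avg => i.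
  rewrite /comp avg_map; apply: eq_avg => j; rewrite /comp.
  have /= := uf (i%:Z - j%:Z) j; rewrite [j%:Z + _]addrC subrK => ->.
  by rewrite add0r mulr1z.
(* With weight [eps / 2] in [avg_posdef_le], an energy of [eps ^+ 2 / 4] makes the off-diagonal
   averages at most [eps / 2]. *)
have e40 : 0 < eps ^+ 2 / 4 by rewrite divr_gt0// exprn_gt0.
have [q [eta [q0 eta0 Hq]]] := IH _ e40.
pose N := (Num.truncn (2 / eps)).+1.
have N0 : (0 < N)%N by [].
have Ne : N%:R^-1 <= eps / 2.
  rewrite -[leRHS]invrK lef_pV2 ?posrE ?ltr0n ?invr_gt0 ?divr_gt0//.
  by rewrite invf_div ltW// truncnS_gt.
(* Every nonzero difference of two elements of [T] divides the factorial of [N], so one multiplier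
   covers them all. *)
exists (q * N`!)%N, eta; split=> //; first by rewrite muln_gt0 q0 fact_gt0.
move=> G psi u pd psi1 small.
pose T := map Posz (iota 0 N).
have szT : size T = N by rewrite size_map size_iota.
have uT : uniq T by rewrite map_inj_uniq ?iota_uniq// => i j [].
have T0 : (0 < size T)%N by rewrite szT.
pose us := [seq u *~ (h - h') | h <- T, h' <- [seq h' <- T | h != h']].
have usP : {in us, forall v, exists S, good (eps ^+ 2 / 4) D.+1 v psi S}.
  move=> v /allpairsPdep[h [h' [hT]]]; rewrite mem_filter => /andP[hh' h'T] ->.
  apply: Hq => //; apply: le_lt_trans small.
  have [k kN] : exists k : int, (N`!)%:Z = (h - h') * k.
    suff /dvdzP[k ->] : (h - h' %| (N`!)%:Z)%Z by exists k; rewrite mulrC.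
    rewrite dvdzE dvdn_fact//.
    case/mapP: hT hh' => i; rewrite mem_iota => iN ->.
    case/mapP: h'T => j; rewrite mem_iota => jN -> ij.
    move: ij; rewrite eqz_nat; lia.
  have -> : u *~ (q * N`!)%N = u *~ (h - h') *~ q *~ k.
    by rewrite PoszM kN -!mulrzA; congr (_ *~ _); ring.
  exact: pdle0 (proj_mulz_le _ _ pd).
have [S S0 gS] := good_common pd usP.
exists (sumset S T); split=> [|f uf]; first exact: size_sumset_gt0.
rewrite (le_trans (energy_sumset_le _ _ _ _))// /energy exchange_avg.
under eq_avg do rewrite exchange_avg.
(* The diagonal has density [1 / N <= eps / 2] and is bounded trivially by [psi 0 <= 1]. *)
apply: (@le_trans _ _ (avg T (fun h => avg T (fun h' => (h == h')%:R * 1 + eps / 2)))).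
  apply: avg_le => h hT; apply: avg_le => h' h'T.
  have [<-|hh'] := eqVneq h h'.
    under eq_avg do rewrite subrr; rewrite avg_cst//.
    by rewrite mul1r (le_trans psi1)// lerDl divr_ge0// ltW.
  rewrite mul0r add0r.
  have [|_ /(_ _ (lead_diff h h' uf)) ge] := gS (u *~ (h - h')).
    by apply/allpairsPdep; exists h, h'; rewrite mem_filter hh'.
  have e20 : 0 < eps / 2 by rewrite divr_gt0.
  rewrite (le_trans (avg_posdef_le _ _ pd e20))//.
  rewrite ler_pdivrMr// [leRHS](_ : _ = eps / 2 + eps / 2); last by field.
  rewrite lerD//; last by rewrite ler_piMr// ltW.
  rewrite ler_pdivrMr//; apply: le_trans ge _.
  by rewrite le_eqVlt; apply/orP; left; apply/eqP; field.
rewrite avg_pair_eq_le// szT div1r; lra.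
Qed.

End VanDerCorput.

(** * Averages along polynomial curves *)

Definition curve (G : zmodType) (vs : seq G) (t : int) : G :=
  \sum_(0 <= i < size vs) vs`_i *~ t ^+ i.+1.

Lemma curve_rcons (G : zmodType) (vs : seq G) w t :
  curve (rcons vs w) t = curve vs t + w *~ t ^+ (size vs).+1.
Proof.
rewrite /curve size_rcons big_nat_recr//= nth_rcons ltnn eqxx; congr (_ + _).
by apply: eq_big_nat => i /andP[_ ivs]; rewrite nth_rcons ivs.
Qed.

Lemma lead_curve (G : zmodType) (vs : seq G) w c q :
  lead (size vs).+1 (w *~ ((size vs).+1`!%:Z * q ^+ (size vs).+1))
    (fun t => curve (rcons vs w) (c + q * t)).
Proof.
have pow n : lead n (n`!%:Z * q ^+ n) (fun t => (c + q * t) ^+ n).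
  have := lead_prod q (nseq n c); rewrite size_nseq; congr lead.
  by apply/funext => t; rewrite big_nseq iter_mulr_1.
elim/last_ind: vs w => [|vs v IH] w.
  have := lead_mulz w (pow 1%N); congr lead; apply/funext => t.
  by rewrite curve_rcons /curve big_nil add0r.
rewrite size_rcons -[w *~ _]add0r.
rewrite (_ : (fun t => _) = (fun t => curve (rcons vs v) (c + q * t)) \+
    (fun t => w *~ (c + q * t) ^+ (size vs).+2)).
  by apply: leadD (lead_mulz w (pow _)); exact: leadW (IH v).
by apply/funext => t; rewrite curve_rcons size_rcons.
Qed.

Lemma energy_shift_in (R : realType) (G : zmodType) (phi : G -> R) S f g :
  {in S &, forall s s', phi (f s - f s') = phi (g s - g s')} ->
  energy phi S f = energy phi S g.
Proof.
move=> fg; apply: eq_avg_in => s sS; apply: eq_avg_in => s' s'S; exact: fg.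
Qed.

Lemma energy_dilate (R : realType) (G : zmodType) (phi : G -> R) q S f :
  energy phi [seq q * s | s <- S] f = energy phi S (fun s => f (q * s)).
Proof. by rewrite /energy avg_map; apply: eq_avg => i; rewrite /comp avg_map. Qed.

(** Otherwise [n] rises of at least [eta] would exceed 1. *)
Lemma bounded_increment (R : realType) (x : nat -> R) (eta : R) (n : nat) :
  0 <= x 0%N -> x n <= 1 -> 1 < n%:R * eta -> exists2 i, (i < n)%N & x i.+1 < x i + eta.
Proof.
move=> x0 xn neta; apply: contrapT => H.
suff: n%:R * eta <= x n by lra.
have [m mn] : exists m, m = n by exists n.
rewrite -{1 2}mn; have : (m <= n)%N by rewrite mn.
elim: m {mn} => [|m IH] mn; first by rewrite mul0r.
have h := IH (ltnW mn).
have : ~ x m.+1 < x m + eta by move=> h'; apply: H; exists m.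
by move=> /negP; rewrite -leNgt -addn1 natrD mulrDl mul1r; lra.
Qed.

Lemma dvdn_prod_iota (F : nat -> nat) i n : (i < n)%N -> (F i %| \prod_(j < n) F j)%N.
Proof. by move=> i_n; rewrite (bigD1 (Ordinal i_n))//= dvdn_mulr. Qed.

(** Induction on the degree. Times divisible by a prescribed [m] let the inductive hypothesis be
    used where the top term is invisible; the free base point [a] absorbs the shifts by the other
    summand of a sumset. *)
Lemma curve_energy (R : realType) (D : nat) (eps : R) (m : nat) :
  0 < eps -> (0 < m)%N ->
  exists Q : nat, (0 < Q)%N /\
    forall (G : zmodType) (phi : G -> R) (vs : seq G),
      size vs = D -> posdef phi -> phi 0 <= 1 ->
      exists S : seq int, [/\ (0 < size S)%N, {in S, forall s, (m %| s)%Z} &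
        forall a, energy phi S (fun t => curve vs (a + t)) <=
          D%:R * eps + projs [seq v *~ Q | v <- vs] phi 0].
Proof.
move=> e0; elim: D m => [|D IH] m m0.
  exists 1%N; split=> // G phi vs /size0nil -> pd phi1; exists [:: 0]; split => //.
    by move=> s; rewrite inE => /eqP ->; rewrite dvdz0.
  move=> a; rewrite mul0r add0r /energy; apply: avg_le_cst => // s _.
  by apply: avg_le_cst => // s' _; rewrite /curve !big_nil subrr.
have [q0 [eta [q0_gt0 eta0 vdc]]] := van_der_corput D e0.
(* [q i.+1] is [q0] times the factor that the leading coefficient acquires when time is restricted
   to multiples of [q i]. *)
pose q i := iter i (fun q => q0 * (D.+1`! * q ^ D.+1))%N m.
have q_gt0 i : (0 < q i)%N.
  elim: i => //= i IHi; rewrite !muln_gt0 q0_gt0 fact_gt0/=.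
  by rewrite expn_gt0 IHi.
have qS i : (q i %| q i.+1)%N.
  by rewrite /= expnS -[(q0 * _)%N]mulnC mulnAC [(_ * (_ * _))%N]mulnCA -mulnA dvdn_mulr.
have mq i : (m %| q i)%N.
  by elim: i => // i IHi; exact: dvdn_trans IHi (qS i).
pose n := (Num.truncn (eta^-1)).+1.
have neta : 1 < n%:R * eta by rewrite -ltr_pdivrMr// div1r truncnS_gt.
have /choice[F HF] : forall i, exists Q : nat, (0 < Q)%N /\ _ := fun i => IH (q i) (q_gt0 i).
(* The index found by pigeonhole depends on [phi], so [Q] is a common multiple over all
   candidates. *)
exists (\prod_(i < n) (F i * q i))%N; split.
  by rewrite prodn_gt0// => i; rewrite muln_gt0 (HF _).1 q_gt0.
set Q := (\prod_(i < n) _)%N.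
move=> G phi vs'; case/lastP: vs' => // vs w; rewrite size_rcons => -[szvs] pd phi1.
have bp := posdef_bdd pd.
pose x i := proj (w *~ q i) phi 0.
have compl0 v : proj v phi 0 <= phi 0.
  by have /posdef0_ge0 := proj_compl_posdef v pd; rewrite subr_ge0.
(* Pigeonhole: between some consecutive multipliers the mass of the invariant part of [phi] grows by
   less than [eta]. *)
have [||i i_n xi] := @bounded_increment R x eta n _ _ neta.
- exact/posdef0_ge0/proj_posdef.
- exact: le_trans (compl0 _) phi1.
have [QF Qq] : (exists l, Q = F i * l)%N /\ (exists l, Q = q i * l)%N.
  have /dvdnP[l Ql] : (F i * q i %| Q)%N := dvdn_prod_iota (fun i => F i * q i)%N i_n.
  by split; [exists (l * q i)%N|exists (l * F i)%N]; rewrite Ql; ring.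
have [_ {}HF] := HF i.
set phiq := proj (w *~ q i) phi.
have pdq : posdef phiq by exact: proj_posdef.
have invq : invariant (w *~ q i) phiq by exact: proj_invariant.
have phiq1 : phiq 0 <= 1 by exact: le_trans (compl0 _) phi1.
have [SB [SB0 SBq HSB]] := HF G phiq vs szvs pdq phiq1.
pose psi y := phi y - phiq y.
have pdpsi : posdef psi by exact: proj_compl_posdef.
have psi1 : psi 0 <= 1.
  by rewrite /psi (le_trans _ phi1)// lerBlDr lerDl posdef0_ge0.
(* The mean of [psi] along [w *~ q i.+1] is exactly that growth, hence below the van der Corput
   threshold. *)
have [|SA [SA0 HSA]] := vdc G psi (w *~ (D.+1`!%:Z * (q i)%:Z ^+ D.+1)) pdpsi psi1.
  have [k kE] := dvdnP (qS i).
  have -> : w *~ (D.+1`!%:Z * (q i)%:Z ^+ D.+1) *~ q0 = w *~ q i.+1.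
    by rewrite -mulrzA /= !PoszM -rmorphXn/=; congr (_ *~ _); ring.
  rewrite projB//; last exact: posdef_bdd.
  rewrite (@invariant_proj _ _ _ phiq) ?ltrBlDl//.
  by rewrite kE mulnC PoszM mulrzA; exact: invariantMz.
(* [SA] controls [psi] whatever the lower-order terms; [SB] controls [phiq], which
   does not see the term of degree [D.+1] along multiples of [q i]. *)
pose SA' := [seq (q i)%:Z * s | s <- SA].
exists (sumset SB SA'); split.
- by rewrite size_sumset_gt0// size_map.
- move=> _ /allpairsP[[b c] /= [/SBq bq /mapP[a _ ->] ->]].
  have mqi : (m %| (q i)%:Z)%Z by rewrite dvdzE; exact: mq.
  by rewrite rpredD ?dvdz_mulr// (dvdz_trans mqi).
move=> a.
have -> : energy phi (sumset SB SA') (fun t => curve (rcons vs w) (a + t)) =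
    energy phiq (sumset SB SA') (fun t => curve (rcons vs w) (a + t)) +
    energy psi (sumset SB SA') (fun t => curve (rcons vs w) (a + t)).
  rewrite /energy -avgD; apply: eq_avg => s; rewrite -avgD; apply: eq_avg => s'.
  by rewrite /psi [RHS]addrC subrK.
rewrite -addn1 natrD mulrDl mul1r addrAC; apply: lerD.
  rewrite sumsetC_energy (le_trans (energy_sumset_le _ _ _ _)) ?size_map//.
  apply: avg_le_cst; rewrite ?size_map// => s _.
  (* The times in [SB] are multiples of [q i], so the top terms differ by multiples of [w *~ q i],
     which [phiq] ignores. *)
  have -> : energy phiq SB (fun j => curve (rcons vs w) (a + (s + j))) =
            energy phiq SB (fun j => curve vs (a + s + j)).
    apply: energy_shift_in => b b' bS b'S; rewrite !curve_rcons !addrA.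
    rewrite opprD addrACA -mulrzBr.
    suff [k ->] : exists k, (a + s + b) ^+ (size vs).+1 - (a + s + b') ^+ (size vs).+1 =
        (q i)%:Z * k by rewrite mulrzA invariant_mulz.
    have /dvdzP[k kE] : ((q i)%:Z %| b - b')%Z by rewrite rpredB ?SBq.
    rewrite subrXX.
    have -> : a + s + b - (a + s + b') = (q i)%:Z * k by rewrite mulrC -kE; ring.
    by eexists; rewrite -mulrA.
  rewrite (le_trans (HSB _))// lerD2l.
  rewrite map_rcons /projs foldr_rcons -/(projs _ _).
  (* Two comparisons: pass from [F i] to its multiple [Q], then from [w *~ q i] to [w *~ Q]. *)
  have [l Ql] := QF; have [l' Ql'] := Qq.
  apply: pdle0; apply: (pdle_trans (psi := projs [seq v *~ Q | v <- vs] phiq)).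
    by rewrite Ql PoszM; exact: projs_mulz_le.
  apply: projs_le; [exact: posdef_bdd|exact: proj_bdd|].
  by rewrite /phiq Ql' PoszM mulrzA; exact: proj_mulz_le.
rewrite (le_trans (energy_sumset_le _ _ _ _))//.
apply: avg_le_cst => // b _; rewrite energy_dilate; apply: HSA.
rewrite -szvs; have := lead_curve vs w (a + b) (q i); congr lead.
by apply/funext => t; rewrite addrA.
Qed.

(** * Reduction to one variable *)

(** With [B] above all exponents, this keeps distinct monomials distinct when [t ^+ (B ^ j)] is
    substituted for the [j]-th variable. *)
Lemma digits_inj (B r : nat) (f g : 'I_r -> nat) :
  (forall j, f j < B)%N -> (forall j, g j < B)%N ->
  (\sum_(j < r) f j * B ^ j = \sum_(j < r) g j * B ^ j)%N -> f =1 g.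
Proof.
elim: r f g => [|r IH] f g fB gB; first by move=> _ [].
rewrite !big_ord_recl !expn0 !muln1.
have E (h : 'I_r.+1 -> nat) : (\sum_(i < r) h (lift ord0 i) * B ^ bump 0 i =
    (\sum_(i < r) h (lift ord0 i) * B ^ i) * B)%N.
  by rewrite big_distrl; apply: eq_bigr => i _; rewrite /bump/= expnSr mulnA.
rewrite /= !E => eqfg.
have B0 : (0 < B)%N by apply: leq_ltn_trans (fB ord0).
have e0 : f ord0 = g ord0.
  by move: (congr1 (modn^~ B) eqfg); rewrite ![(_ ord0 + _)%N]addnC !modnMDl !modn_small.
have es : f \o lift ord0 =1 g \o lift ord0.
  apply: IH => [j|j|]; [exact: fB|exact: gB|].
  by apply/eqP; rewrite -(eqn_pmul2r B0); apply/eqP/(@addnI (f ord0)); rewrite eqfg e0.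
by move=> j; case: (unliftP ord0 j) => [i ->|->//]; exact: es.
Qed.

Lemma common_denom (m n : nat) (A : 'M[rat]_(m, n)) :
  exists c : nat, (0 < c)%N /\ exists N : 'M[int]_(m, n), c%:R *: A = map_mx intr N.
Proof.
pose dn i j := `|denq (A i j)|%N.
pose c := (\prod_(i < m) \prod_(j < n) dn i j)%N.
have dn_gt0 i j : (0 < dn i j)%N by rewrite /dn absz_gt0 denq_neq0.
exists c; split; first by rewrite /c; apply: prodn_gt0 => i; apply: prodn_gt0 => j; exact: dn_gt0.
exists (\matrix_(i, j) (numq (A i j) * (c %/ dn i j)%N%:Z)).
apply/matrixP => i j; rewrite !mxE.
have /divnK {1}<- : (dn i j %| c)%N.
  by rewrite /c (bigD1 i)//= (bigD1 j)//= -mulnA dvdn_mulr.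
rewrite natrM rmorphM/= pmulrn -mulrA mulrC; congr (_ * _).
rewrite -[X in _ * X = _]divq_num_den pmulrn gez0_abs ?denq_ge0//.
by rewrite mulrC divfK// intr_eq0 denq_neq0.
Qed.

Lemma mulmxz_entry (m n : nat) (A : 'M[int]_(m, n)) (z : int) i j :
  (A *~ z) i j = A i j * z.
Proof.
have H (k : nat) : (A *+ k) i j = A i j *+ k.
  by elim: k => [|k IH]; rewrite ?mulr0n ?mxE// !mulrS mxE IH.
case: z => k; first by rewrite -pmulrn H pmulrn mulrzz.
by rewrite !NegzE mulrNz -pmulrn !mxE H mulrN pmulrn mulrzz.
Qed.

(** Kronecker substitution. Linear independence gives the matrix of coefficients full column rank;
    clearing the denominators of a rational left inverse by [c] puts [c Z^d] in the span of [vs]. *)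
Lemma kronecker_curve (R : realType) (r d : nat) (P : 'I_d -> mpoly r int) :
  zero_constant_term P -> linearly_independent R P ->
  exists (vs : seq 'rV[int]_d) (c : nat), [/\ (0 < c)%N,
    forall t, exists n, poly_eval P n = curve vs t &
    forall g : 'rV[int]_d, exists k : nat -> int,
      g *~ c = \sum_(0 <= i < size vs) vs`_i *~ k i].
Proof.
move=> P0 Pfree.
pose B := (\max_(i < d) mmeasure (@mdeg r) (P i)).+1.
pose e (m : multinom r) := (\sum_(j < r) m j * B ^ j)%N.
pose D := (\sum_(j < r) B * B ^ j)%N.
have mB i m : m \in msupp (P i) -> forall j, (m j < B)%N.
  move=> mP j; rewrite ltnS; apply: leq_trans (leq_bigmax i).
  apply: ltnW; apply: leq_ltn_trans (msize_mdeg_lt mP).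
  by rewrite mdegE (bigD1 j)//= leq_addr.
have eD i m : m \in msupp (P i) -> (0 < e m <= D)%N.
  move=> mP; rewrite lt0n; apply/andP; split; last first.
    by apply: leq_sum => j _; rewrite leq_mul2r ltnW ?orbT// (mB i).
  apply: contraTneq (mP) => em0; rewrite mcoeff_msupp negbK; apply/eqP.
  suff -> : m = mnm0 by exact: P0.
  apply/mnmP => j; rewrite mnm0E.
  by move/eqP: em0; rewrite sum_nat_eq0 => /forallP/(_ j); rewrite muln_eq0 expn_eq0 orbF => /eqP.
(* [v k] is the coefficient of [t ^+ k.+1]; the zero constant term leaves no exponent 0. *)
pose v k : 'rV[int]_d := \row_i \sum_(m <- msupp (P i) | e m == k.+1) mcoeff m (P i).
pose vs := [seq v k | k <- iota 0 D].
have sz : size vs = D by rewrite size_map size_iota.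
have nthv k : (k < D)%N -> vs`_k = v k.
  by move=> kD; rewrite (nth_map 0%N) ?size_iota// nth_iota.
have vE i m : (e m <= D)%N -> (forall j, m j < B)%N -> (0 < e m)%N ->
    v (e m).-1 0 i = mcoeff m (P i).
  move=> emD mjB em0; rewrite mxE prednK//.
  have [mP|mP] := boolP (m \in msupp (P i)); last first.
    rewrite (memN_msupp_eq0 mP) big_seq_cond big1// => m' /andP[m'P /eqP em'].
    case/negP: mP; suff -> : m = m' by [].
    by apply/mnmP; apply: (@digits_inj B) => // j; exact: mB m'P j.
  rewrite big_mkcond (bigD1_seq m)//= eqxx big_seq_cond big1 ?addr0//.
  move=> m' /andP[m'P m'm]; case: eqP => // em'.
  case/negP: m'm; apply/eqP/mnmP.
  by apply: (@digits_inj B) => // j; exact: mB m'P j.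
pose M : 'M[rat]_(D, d) := \matrix_(k < D, i < d) (v k 0 i)%:~R.
have ME k i : M k i = (v k 0 i)%:~R by rewrite mxE.
(* A relation between the columns of [M] is a relation between the component polynomials, because
   each monomial has its own row. *)
have Mfree : row_free M^T.
  apply: inj_row_free => x xM.
  suff H i : ratr (x 0 i) = 0 :> R.
    by apply/rowP => i; rewrite mxE; apply/eqP; rewrite -(fmorph_eq0 (@ratr R)); apply/eqP/H.
  apply: (Pfree (fun i => ratr (x 0 i))); apply/mpolyP => m.
  rewrite mcoeff0 raddf_sum/=.
  under eq_bigr do rewrite mcoeffZ mcoeff_map_mpoly.
  have [[i0 mP]|nP] := pselect (exists i, m \in msupp (P i)); last first.
    apply: big1 => i' _; rewrite memN_msupp_eq0 ?mulr0//.
    by apply/negP => mP; apply: nP; exists i'.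
  have /andP[em0 emD] := eD i0 m mP.
  have kD : ((e m).-1 < D)%N by rewrite prednK.
  have := congr1 (fun A : 'rV[rat]_D => ratr (A 0 (Ordinal kD)) : R) xM.
  rewrite [(x *m _) _ _]mxE mxE rmorph0 rmorph_sum/= => H; rewrite -[RHS]H; apply: eq_bigr => i' _.
  by rewrite [M^T _ _]mxE ME rmorphM/= ratr_int vE//; exact: mB mP.
have [N MN] := row_freeP Mfree.
have [c [c0 [N' N'E]]] := common_denom N.
exists vs, c; split=> // [t|g].
  exists (\row_j t ^+ (B ^ j)); apply/rowP => i; rewrite mxE mevalE.
  rewrite /curve sz summxE big_mkord.
  transitivity (\sum_(k < D) \sum_(m <- msupp (P i) | e m == k.+1)
      mcoeff m (P i) * t ^+ e m); last first.
    apply: eq_bigr => k _; rewrite nthv// mulmxz_entry.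
    rewrite mxE mulr_suml; apply: eq_bigr => m /eqP <-//.
  rewrite (exchange_big_dep xpredT)//= big_seq [RHS]big_seq; apply: eq_bigr => m mP.
  have /andP[em0 emD] := eD i m mP.
  have kD : ((e m).-1 < D)%N by rewrite prednK.
  rewrite (big_pred1 (Ordinal kD)) => [|k]; last first.
    by rewrite /= -val_eqE /= -[RHS]eqSS prednK// eq_sym.
  congr (_ * _); rewrite /e expr_sum; apply: eq_bigr => j _.
  by rewrite mxE -exprM mulnC.
pose K := g *m N'^T.
(* Indices from [D] on, outside the range of the sum, get the default 0. *)
exists (fun k => if insub k is Some k' then K 0 k' else 0).
apply/rowP => i; rewrite sz big_mkord summxE mulmxz_entry.
apply: (@intr_inj rat).
transitivity ((map_mx (intr : int -> rat) g *m (c%:R *: N)^T *m M) 0 i).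
  rewrite linearZ/= -scalemxAr -scalemxAl -mulmxA.
  have -> : N^T *m M = 1%:M by rewrite -[M]trmxK -trmx_mul MN trmx1.
  by rewrite mulmx1 !mxE rmorphM/= mulrC.
rewrite N'E map_trmx -map_mxM [LHS]mxE rmorph_sum; apply: eq_bigr => k _.
by rewrite valK nthv// mulmxz_entry rmorphM/= ME mulrC; congr (_ * _); rewrite [LHS]mxE.
Qed.

(** * Invariant measures and ergodic components *)

Section RealProbability.
Context (disp : measure_display) (X : measurableType disp) (R : realType).
Implicit Types (mu : probability X R) (A B : set X).

Definition pr mu A : R := fine (mu A).

Lemma prE mu A : measurable A -> mu A = (pr mu A)%:E.
Proof. by move=> mA; rewrite fineK// fin_num_measure. Qed.

Lemma pr_ge0 mu A : 0 <= pr mu A.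
Proof. exact: fine_ge0. Qed.

Lemma pr0 mu : pr mu set0 = 0.
Proof. by rewrite /pr measure0. Qed.

Lemma pr_setT mu : pr mu setT = 1.
Proof. by rewrite /pr probability_setT. Qed.

Lemma pr_le mu A B : measurable A -> measurable B -> A `<=` B -> pr mu A <= pr mu B.
Proof.
by move=> mA mB AB; rewrite -lee_fin -!prE// le_measure// inE.
Qed.

Lemma pr_le1 mu A : measurable A -> pr mu A <= 1.
Proof. by move=> mA; rewrite -(pr_setT mu); exact: pr_le. Qed.

Lemma prU mu A B : measurable A -> measurable B -> A `&` B = set0 ->
  pr mu (A `|` B) = pr mu A + pr mu B.
Proof.
move=> mA mB AB; apply/EFin_inj; rewrite EFinD -!prE//; last exact: measurableU.
exact: measureU.
Qed.

Lemma pr_sigma mu (F : nat -> set X) : (forall i, measurable (F i)) ->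
  trivIset setT F ->
  (fun n => \sum_(0 <= i < n) pr mu (F i)) @ \oo --> pr mu (\bigcup_i F i).
Proof.
move=> mF tF.
have mUF : measurable (\bigcup_i F i) by exact: bigcup_measurable.
have : (fun n => \sum_(0 <= i < n) mu (F i))%E @ \oo --> (pr mu (\bigcup_i F i))%:E.
  by rewrite -prE//; exact: measure_semi_sigma_additive.
move=> /fine_cvgP[_].
have E n : (\sum_(0 <= i < n) mu (F i))%E = (\sum_(0 <= i < n) pr mu (F i))%:E.
  by rewrite -sumEFin; apply: eq_bigr => i _; rewrite prE.
rewrite (_ : fine \o _ = fun n => \sum_(0 <= i < n) pr mu (F i)); last first.
  by apply/funext => n /=; rewrite E.
by [].
Qed.

(** The form is the integral of the square of the weighted sum of indicators. *)
Lemma inter_posdef mu (s : seq (R * set X)) : (forall p, p \in s -> measurable p.2) ->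
  0 <= wform (fun A B => pr mu (A `&` B)) s s.
Proof.
move=> ms; rewrite /wform.
pose f x : R := \sum_(p <- s) p.1 * \1_p.2 x.
have : (0 <= \int[mu]_x ((f x) ^+ 2)%:E)%E.
  by apply: integral_ge0 => x _; rewrite lee_fin sqr_ge0.
pose h (pq : (R * set X) * (R * set X)) x : \bar R :=
  ((pq.1.1 * pq.2.1)%:E * (\1_(pq.1.2 `&` pq.2.2) x)%:E)%E.
pose ss := [seq (p, q) | p <- s, q <- s].
have mss pq : pq \in ss -> measurable (pq.1.2 `&` pq.2.2).
  by case/allpairsP => -[p q] /= [ps qs ->] /=; apply: measurableI; exact: ms.
(* Integrability is asked at every index while measurability is known only on the list, hence the
   value 0 elsewhere. *)
pose h' pq : X -> \bar R := if pq \in ss then h pq else cst 0%E.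
have hint pq : mu.-integrable setT (h' pq).
  rewrite /h'; case: ifPn => [/mss m|_]; last exact: integrable0.
  by apply: integrableZl => //; exact: integrable_indic.
under eq_integral => x _.
  rewrite (_ : _%:E = \sum_(pq <- ss) h' pq x)%E; last first.
    rewrite big_seq (eq_bigr (fun pq => h pq x)) => [|pq pqs]; last by rewrite /h' pqs.
    rewrite -big_seq expr2 /f mulr_suml -sumEFin big_allpairs_dep/=.
    apply: eq_bigr => p _; rewrite mulr_sumr -sumEFin; apply: eq_bigr => q _.
    by rewrite /h/= indicI -EFinM/= mulrACA.
  over.
rewrite integral_sum//.
rewrite (_ : (\sum_(k <- ss) _)%E =
    (\sum_(p <- s) \sum_(q <- s) p.1 * q.1 * pr mu (p.2 `&` q.2))%:E) ?lee_fin//.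
rewrite big_seq (eq_bigr (fun pq => (pq.1.1 * pq.2.1 * pr mu (pq.1.2 `&` pq.2.2))%:E)).
  by rewrite -big_seq big_allpairs_dep/= -sumEFin; apply: eq_bigr => p _; rewrite -sumEFin.
move=> pq pqs; rewrite /h' pqs integralZl//; last exact/integrable_indic/mss.
rewrite integral_indic ?setIT//; last exact: mss.
by rewrite [RHS]EFinM; congr (_ * _)%E; exact/prE/mss.
Qed.

End RealProbability.

(** * Hahn decomposition of dominated additive functions *)

Section DominatedCharge.
Context (disp : measure_display) (X : measurableType disp) (R : realType).
Context (nu : probability X R) (kappa : set X -> R) (C : R).
Context (kappaU : forall A B, measurable A -> measurable B -> A `&` B = set0 ->
  kappa (A `|` B) = kappa A + kappa B).
Context (kappa_le : forall A, measurable A -> `|kappa A| <= C * pr nu A).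

Let kappa0 : kappa set0 = 0.
Proof.
by have := kappa_le measurable0; rewrite pr0 mulr0 normr_le0 => /eqP.
Qed.

(** The remainder of the series is [kappa] of the part of the union not yet covered, at most [C]
    times its [nu]-measure, which tends to 0. *)
Let sigma_kappa : semi_sigma_additive (EFin \o kappa).
Proof.
move=> F mF tF mUF; rewrite /comp.
have E n : (\sum_(0 <= i < n) (kappa (F i))%:E)%E = (\sum_(0 <= i < n) kappa (F i))%:E.
  by rewrite -sumEFin.
rewrite (_ : (fun n => _) = fun n => (\sum_(0 <= i < n) kappa (F i))%:E); last first.
  by apply/funext => n.
apply: cvg_EFin; first by apply: nearW.
rewrite (_ : fine \o _ = fun n => \sum_(0 <= i < n) kappa (F i)); last by apply/funext.
apply/cvgrPdist_le => e e0.
pose U n := \big[setU/set0]_(i < n) F i.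
have mU n : measurable (U n) by exact: bigsetU_measurable.
have FU n : F n `&` U n = set0.
  rewrite /U -bigcup_mkord setI_bigcupr; apply: bigcup0 => i /= i_n.
  move/trivIsetP : tF => /(_ n i Logic.I Logic.I); apply.
  by rewrite gtn_eqF.
have US n : U n.+1 = F n `|` U n by rewrite /U big_ord_recr/= setUC.
have kU n : kappa (U n) = \sum_(0 <= i < n) kappa (F i).
  elim: n => [|n IH]; first by rewrite /U big_ord0 big_nil kappa0.
  by rewrite US kappaU// big_nat_recr//= IH addrC.
have pU n : pr nu (U n) = \sum_(0 <= i < n) pr nu (F i).
  elim: n => [|n IH]; first by rewrite /U big_ord0 big_nil pr0.
  by rewrite US prU// big_nat_recr//= IH addrC.
set V := \bigcup_n F n.
have UV n : U n `<=` V.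
  by rewrite /U -bigcup_mkord; apply: bigcup_sub => i _; exact: bigcup_sup.
have VE n : V = (V `\` U n) `|` U n by rewrite setUC setDUK.
have disj n : (V `\` U n) `&` U n = set0 by rewrite setDE -setIA setICl setI0.
have mD n : measurable (V `\` U n) by exact: measurableD.
have bound n : `|kappa V - \sum_(0 <= i < n) kappa (F i)| <=
    C * (pr nu V - \sum_(0 <= i < n) pr nu (F i)).
  rewrite -kU -pU {1}(VE n) {2}(VE n) kappaU// prU// !addrK; exact: kappa_le.
have : (fun n => C * (pr nu V - \sum_(0 <= i < n) pr nu (F i))) @ \oo --> C * (pr nu V - pr nu V).
  by apply: cvgMr; apply: cvgB; [exact: cvg_cst|exact: pr_sigma].
rewrite subrr mulr0 => /cvgr0Pnorm_le /(_ e e0); apply: filterS => n.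
by move=> h; rewrite (le_trans (bound n))// (le_trans _ h)// ler_norm.
Qed.

(** The last clause allows the negative part to be saturated under a countable group. *)
Lemma dominated_hahn : exists P N : set X,
  [/\ measurable P, measurable N, P `|` N = setT,
      forall A, measurable A -> A `<=` P -> 0 <= kappa A &
      forall A, measurable A -> A `<=` N -> kappa A <= 0] /\
  forall F : nat -> set X,
    (forall i, measurable (F i) /\
       forall A, measurable A -> A `<=` F i -> kappa A <= 0) ->
    forall A, measurable A -> A `<=` \bigcup_i F i -> kappa A <= 0.
Proof.
have K0 : (EFin \o kappa) set0 = 0%E by rewrite /= kappa0.
have K_fin A : measurable A -> (EFin \o kappa) A \is a fin_num by [].
pose K : {charge set X -> \bar R} :=
  HB.pack (EFin \o kappa) (isCharge.Build _ _ _ (EFin \o kappa) K0 K_fin sigma_kappa).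
have [P [N [[mP posP] [mN negN] PN _]]] := Hahn_decomposition K.
exists P, N; split.
  split=> // A mA AB; rewrite -lee_fin; first [exact: posP|exact: negN].
move=> F HF A mA AF; rewrite -lee_fin.
have nF i : negative_set K (F i).
  by have [mFi h] := HF i; split=> // B mB BF; rewrite /K lee_fin; exact: h.
exact: (bigcup_negative_set nF).2.
Qed.

End DominatedCharge.

Section Actions.
Context (disp : measure_display) (X : measurableType disp) (R : realType) (d : nat).
Implicit Types (mu nu : probability X R) (T : 'rV[int]_d -> X -> X) (A B C : set X).

Lemma measurable_act mu T n A : measure_preserving_action mu T ->
  measurable A -> measurable (T n @^-1` A).
Proof. by move=> [_ mT _] mA; rewrite -[X in measurable X]setTI; exact: mT. Qed.

Lemma pr_act mu T n A : measure_preserving_action mu T ->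
  measurable A -> pr mu (T n @^-1` A) = pr mu A.
Proof. by move=> [_ _ pT] mA; rewrite /pr pT. Qed.

Lemma preimage_actD mu T m n A : measure_preserving_action mu T ->
  T m @^-1` (T n @^-1` A) = T (m + n) @^-1` A.
Proof.
by move=> [[_ TD] _ _]; apply/seteqP; split => x; rewrite /preimage/= [m + n]addrC TD.
Qed.

Lemma preimage_act0 mu T A : measure_preserving_action mu T -> T 0 @^-1` A = A.
Proof. by move=> [[T0 _] _ _]; apply/seteqP; split => x; rewrite /preimage/= T0. Qed.

Lemma image_act mu T n A : measure_preserving_action mu T -> T n @` A = T (- n) @^-1` A.
Proof.
move=> [[T0 TD] _ _]; apply/seteqP; split => [_ [x Ax <-]|x Ax].
  by rewrite /preimage/= -TD addNr T0.
by exists (T (- n) x) => //; rewrite -TD subrr T0.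
Qed.

Lemma invariant_setC T C : invariant_set T C -> invariant_set T (~` C).
Proof. by move=> iC n; rewrite -preimage_setC iC. Qed.

Lemma invariant_setI T C D : invariant_set T C -> invariant_set T D ->
  invariant_set T (C `&` D).
Proof. by move=> iC iD n; rewrite preimage_setI iC iD. Qed.

Lemma invariant_setD T C D : invariant_set T C -> invariant_set T D ->
  invariant_set T (C `\` D).
Proof. by move=> iC iD; rewrite setDE; apply: invariant_setI => //; exact: invariant_setC. Qed.

Lemma ergodic_pr mu T C : ergodic_action mu T -> measurable C ->
  invariant_set T C -> pr mu C = 0 \/ pr mu C = 1.
Proof.
by move=> [_ erg] mC iC; have [h|h] := erg _ mC iC; [left|right]; rewrite /pr h.
Qed.

Lemma saturation_invariant mu T A : measure_preserving_action mu T ->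
  invariant_set T (\bigcup_n (T n @^-1` A)).
Proof.
move=> mpT m; rewrite preimage_bigcup; apply/seteqP; split => x [n _].
  by rewrite (preimage_actD _ _ _ mpT) => h; exists (m + n).
by move=> h; exists (n - m) => //; rewrite (preimage_actD _ _ _ mpT) addrC subrK.
Qed.

Lemma measurable_saturation mu T A : measure_preserving_action mu T ->
  measurable A -> measurable (\bigcup_n (T n @^-1` A)).
Proof.
move=> mpT mA; apply: countable_bigcupT_measurable => [|n]; first exact: countableP.
exact: measurable_act mpT mA.
Qed.

(** Split [kappa = lam - lam(X) nu] by Hahn. The saturation [W] of the negative part is still
    negative and is invariant, so it is null or conull and [kappa] has a constant sign; since
    [kappa setT = 0], it vanishes. *)
Lemma ergodic_unique nu T (lam : set X -> R) (K : R) : ergodic_action nu T ->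
  (forall A B, measurable A -> measurable B -> A `&` B = set0 ->
    lam (A `|` B) = lam A + lam B) ->
  (forall A, measurable A -> 0 <= lam A <= K * pr nu A) ->
  (forall n A, measurable A -> lam (T n @^-1` A) = lam A) ->
  forall A, measurable A -> lam A = lam setT * pr nu A.
Proof.
move=> ergT lamU lam_le lamT.
have [mpT _] := ergT.
pose kappa A := lam A - lam setT * pr nu A.
have lam1 : 0 <= lam setT by have /andP[] := lam_le _ measurableT.
have kappaU A B : measurable A -> measurable B -> A `&` B = set0 ->
    kappa (A `|` B) = kappa A + kappa B.
  by move=> mA mB AB; rewrite /kappa lamU// prU//; ring.
have kappa_le A : measurable A -> `|kappa A| <= (K + lam setT) * pr nu A.
  move=> mA; have /andP[l0 lK] := lam_le A mA.
  rewrite (le_trans (ler_normB _ _))// mulrDl lerD//; first by rewrite ger0_norm.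
  by rewrite normrM !ger0_norm ?pr_ge0.
have kappaT : kappa setT = 0 by rewrite /kappa pr_setT mulr1 subrr.
have kappa_act n A : measurable A -> kappa (T n @^-1` A) = kappa A.
  by move=> mA; rewrite /kappa lamT// (pr_act n mpT).
have [P [N [[mP mN PN posP negN] negU]]] := dominated_hahn kappaU kappa_le.
pose W := \bigcup_n (T n @^-1` N).
have mW : measurable W by exact: measurable_saturation mpT mN.
have negW A : measurable A -> A `<=` W -> kappa A <= 0.
  move=> mA AW.
  pose F i := if unpickle i is Some n then T n @^-1` N else set0.
  apply: (negU F) => // [i|].
    rewrite /F; case: unpickle => [n|]; last first.
      split=> // B mB; rewrite subset0 => ->.
      by have := kappa_le _ measurable0; rewrite pr0 mulr0 normr_le0 => /eqP ->.
    split; first exact: measurable_act mpT mN.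
    move=> B mB BN; rewrite -(kappa_act (- n))//; apply: negN.
      exact: measurable_act mpT mB.
    have -> : N = T (- n) @^-1` (T n @^-1` N).
      by rewrite (preimage_actD _ _ _ mpT) addNr (preimage_act0 _ mpT).
    exact: preimage_subset.
  by move=> x /AW [n _ Nx]; exists (pickle n) => //; rewrite /F pickleK.
have posW A : measurable A -> A `<=` ~` W -> 0 <= kappa A.
  move=> mA AW; apply: posP => // x /AW nWx.
  have : (P `|` N) x by rewrite PN.
  case=> // Nx; case: nWx; exists 0 => //.
  by rewrite (preimage_act0 _ mpT).
have split A : measurable A -> kappa A = kappa (A `&` W) + kappa (A `&` ~` W).
  move=> mA; rewrite -kappaU.
  - by rewrite -setIUr setUCr setIT.
  - exact: measurableI.
  - by apply: measurableI => //; exact: measurableC.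
  - by rewrite setIACA setICr setI0.
have null A B : measurable A -> measurable B -> pr nu B = 0 -> kappa (A `&` B) = 0.
  move=> mA mB B0; apply/eqP; rewrite -normr_le0.
  rewrite (le_trans (kappa_le _ _))//; first exact: measurableI.
  suff -> : pr nu (A `&` B) = 0 by rewrite mulr0.
  apply/eqP; rewrite eq_le pr_ge0 -B0 pr_le//; exact: measurableI.
have mCW : measurable (~` W) by exact: measurableC.
(* Complements reverse the sign, so a one-sided bound on all sets suffices. *)
have sym A : measurable A -> kappa (~` A) = - kappa A.
  move=> mA; apply/eqP; rewrite -addr_eq0 -kappaU//.
  - by rewrite setUC setUCr kappaT.
  - exact: measurableC.
  - by rewrite setIC setICr.
suff K0 A : measurable A -> kappa A = 0.
  by move=> A mA; apply/eqP; rewrite -subr_eq0 -/(kappa A) K0.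
move=> mA; apply/eqP; rewrite eq_le.
have [W0|W1] := ergodic_pr ergT mW (saturation_invariant N mpT).
  have pos B : measurable B -> 0 <= kappa B.
    move=> mB; rewrite split// null// add0r posW//; exact: measurableI.
  by rewrite -oppr_ge0 -sym// !pos//; exact: measurableC.
have CW0 : pr nu (~` W) = 0.
  have := @prU _ _ _ nu W (~` W) mW mCW (setICr W).
  rewrite setUCr pr_setT W1 => h; lra.
have neg B : measurable B -> kappa B <= 0.
  move=> mB; rewrite split// (null _ (~` W))// addr0 negW//; exact: measurableI.
by rewrite -oppr_le0 -sym// !neg//; exact: measurableC.
Qed.

End Actions.

(** * Existence of the ergodic components of [T^k] *)

Section ErgodicDecomposition.
Context (disp : measure_display) (X : measurableType disp) (R : realType) (d : nat).
Context (mu : probability X R) (T : 'rV[int]_d -> X -> X) (k : nat).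
Context (ergT : ergodic_action mu T) (k_gt0 : (0 < k)%N).
Implicit Types (A B C D : set X) (F : nat -> set X).

Let mpT : measure_preserving_action mu T := ergT.1.

Lemma act_pow_preserving : measure_preserving_action mu (act_pow T k).
Proof.
have [[T0 TD] mT pT] := mpT; split; [split|..] => *; rewrite /act_pow.
- by rewrite mul0rn T0.
- by rewrite mulrnDl TD.
- exact: mT.
- exact: pT.
Qed.

Lemma pr_bigsetU_le (I : Type) (s : seq I) (G : I -> set X) :
  (forall i, measurable (G i)) ->
  pr mu (\big[setU/set0]_(i <- s) G i) <= \sum_(i <- s) pr mu (G i).
Proof.
move=> mG; elim: s => [|i s IH]; first by rewrite !big_nil pr0.
have mU : measurable (\big[setU/set0]_(i <- s) G i) by exact: bigsetU_measurable.
rewrite !big_cons; apply: le_trans (lerD (lexx (pr mu (G i))) IH).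
set U := \big[setU/set0]_(i <- s) G i in mU *.
have -> : G i `|` U = (G i `\` U) `|` U.
  by rewrite setDE setUIl [~` _ `|` _]setUC setUCr setIT.
rewrite prU//.
- by rewrite lerD// pr_le//; exact: measurableD.
- exact: measurableD.
- by rewrite setDE -setIA setICl setI0.
Qed.

Definition coset_rep (f : {ffun 'I_d -> 'I_k}) : 'rV[int]_d := \row_i (f i)%:Z.

Lemma preimage_coset_rep C n : invariant_set (act_pow T k) C ->
  exists f, T n @^-1` C = T (coset_rep f) @^-1` C.
Proof.
move=> iC.
have lt_k i : (absz (modz (n 0%R i) k) < k)%N.
  by rewrite -ltz_nat gez0_abs ?modz_ge0 ?ltz_pmod// eqz_nat -lt0n.
exists [ffun i => Ordinal (lt_k i)].
set g := coset_rep _.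
pose q : 'rV[int]_d := \row_i divz (n 0 i) k.
have -> : n = g + q *+ k.
  apply/rowP => i; rewrite mxE -[q *+ k]scaler_nat !mxE ffunE /=.
  rewrite gez0_abs ?modz_ge0 ?eqz_nat -?lt0n//.
  by rewrite addrC [_%:R * _]mulrC natz -divz_eq.
by rewrite -(preimage_actD _ _ _ mpT); congr (_ @^-1` _); rewrite -[RHS](iC q).
Qed.

(** By ergodicity the saturation of [C] under the whole action has full measure, and a translate of
    [C] depends only on the class of the translation modulo [k]. *)
Lemma saturation_finite C B : measurable C -> measurable B ->
  invariant_set (act_pow T k) C -> 0 < pr mu C ->
  pr mu B <= \sum_(f : {ffun 'I_d -> 'I_k}) pr mu (B `&` T (coset_rep f) @^-1` C).
Proof.
move=> mC mB iC C0.
have mTC n : measurable (T n @^-1` C) by exact: measurable_act mpT mC.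
pose S := \bigcup_n (T n @^-1` C).
have mS : measurable S by exact: measurable_saturation mpT mC.
have S1 : pr mu S = 1.
  case: (ergodic_pr ergT mS (saturation_invariant C mpT)) => // S0.
  suff : pr mu C <= pr mu S by rewrite S0 leNgt C0.
  apply: pr_le => // x Cx; exists 0 => //.
  by rewrite (preimage_act0 _ mpT).
have CS0 : pr mu (~` S) = 0.
  have := @prU _ _ _ mu S (~` S) mS (measurableC mS) (setICr S).
  rewrite setUCr pr_setT S1 => h; lra.
have mBS : measurable (B `&` S) by exact: measurableI.
have mBCS : measurable (B `&` ~` S) by apply: measurableI => //; exact: measurableC.
have -> : pr mu B = pr mu (B `&` S).
  have BCS0 : pr mu (B `&` ~` S) = 0.
    apply/eqP; rewrite eq_le pr_ge0 -CS0 pr_le//; exact: measurableC.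
  rewrite -[LHS](_ : pr mu ((B `&` S) `|` (B `&` ~` S)) = _).
    by rewrite prU// ?BCS0 ?addr0// setIACA setICr setI0.
  by rewrite -setIUr setUCr setIT.
apply: le_trans (pr_bigsetU_le _ _) => [|f]; last exact: measurableI.
apply: pr_le => //.
  by apply: bigsetU_measurable => f _; exact: measurableI.
move=> x [Bx [n _ Cx]].
have [f fE] := preimage_coset_rep n iC.
rewrite (bigD1 f)//=; left; split=> //.
by have : (T n @^-1` C) x := Cx; rewrite fE.
Qed.

Definition reps : nat := #|{ffun 'I_d -> 'I_k}|.

(** [reps] translates of [C] cover almost everything. The uniform lower bound limits the size of
    disjoint invariant families. *)
Lemma invariant_pr_ge C : measurable C -> invariant_set (act_pow T k) C ->
  0 < pr mu C -> 1 <= reps%:R * pr mu C.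
Proof.
move=> mC iC C0; rewrite -[leLHS](pr_setT mu).
rewrite (le_trans (saturation_finite mC measurableT iC C0))//.
rewrite (eq_bigr (fun=> pr mu C)) => [|f _]; last by rewrite setTI (pr_act _ mpT).
by rewrite sumr_const mulr_natl.
Qed.

Definition invariant_family m F : Prop :=
  (forall i, (i < m)%N ->
    [/\ measurable (F i), invariant_set (act_pow T k) (F i) & 0 < pr mu (F i)]) /\
  forall i j, (i < m)%N -> (j < m)%N -> i != j -> F i `&` F j = set0.

Lemma pr_bigsetU m F : (forall i, (i < m)%N -> measurable (F i)) ->
  (forall i j, (i < m)%N -> (j < m)%N -> i != j -> F i `&` F j = set0) ->
  measurable (\big[setU/set0]_(i < m) F i) /\
  pr mu (\big[setU/set0]_(i < m) F i) = \sum_(i < m) pr mu (F i).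
Proof.
move=> mF dF.
have mU n : (n <= m)%N -> measurable (\big[setU/set0]_(i < n) F i).
  move=> nm; apply: bigsetU_measurable => i _.
  exact: mF (leq_trans (ltn_ord i) nm).
split; first exact: mU.
have [n nm] : exists n, n = m by exists m.
rewrite -nm; have : (n <= m)%N by rewrite nm.
elim: n {nm} => [|n IH] nm; first by rewrite !big_ord0 pr0.
rewrite !big_ord_recr/= -IH ?(ltnW nm)// prU//.
- exact/mU/ltnW.
- exact: mF.
- rewrite setIC -bigcup_mkord setI_bigcupr; apply: bigcup0 => i /= i_n.
  by apply: dF => //; [exact: ltn_trans nm|rewrite gtn_eqF].
Qed.

Lemma invariant_family_size m F : invariant_family m F -> (m <= reps)%N.
Proof.
move=> [mF dF]; have [|mU prU] := pr_bigsetU _ dF.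
  by move=> i /mF[].
have := pr_le1 mu mU; rewrite prU => le1.
rewrite -(ler_nat R).
apply: (@le_trans _ _ (reps%:R * \sum_(i < m) pr mu (F i))); last by rewrite ler_piMr.
rewrite mulr_sumr -[m in leLHS]card_ord -sumr_const.
by apply: ler_sum => i _; have [? ? ?] := mF i (ltn_ord i); exact: invariant_pr_ge.
Qed.

Lemma invariant_family_add m F D : invariant_family m F -> measurable D ->
  invariant_set (act_pow T k) D -> 0 < pr mu D ->
  (forall i, (i < m)%N -> F i `&` D = set0) ->
  invariant_family m.+1 (fun i => if i == m then D else F i).
Proof.
move=> [mF dF] mD iD D0 FD; split=> [i|i j]; rewrite !ltnS.
  by rewrite leq_eqVlt; case: eqVneq => //= _; exact: mF.
rewrite [(i <= m)%N]leq_eqVlt [(j <= m)%N]leq_eqVlt; case: (eqVneq i m) => [->|im]; case: (eqVneq j m) => [->|jm] //=.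
- by move=> _ jm' _; rewrite setIC FD.
- by move=> im' _ _; rewrite FD.
- exact: dF.
Qed.

(** Maximality is stated for every family [F'] of size [m], not for [F] alone: the proof that the
    members are atoms modifies one of them. *)
Lemma maximal_invariant_family : exists m F, invariant_family m F /\
  forall D, measurable D -> invariant_set (act_pow T k) D -> 0 < pr mu D ->
  forall F', invariant_family m F' -> exists2 i, (i < m)%N & F' i `&` D !=set0.
Proof.
pose Q m := `[< exists F, invariant_family m F >].
have exQ : exists m, Q m.
  by exists 0%N; apply/asboolP; exists (fun=> set0); split.
have leQ m : Q m -> (m <= reps)%N by move=> /asboolP[F]; exact: invariant_family_size.
have [m /asboolP[F famF] maxm] := ex_maxnP exQ leQ.
exists m, F; split=> // D mD iD D0 F' famF'.
apply: contrapT => H.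
suff /maxm : Q m.+1 by rewrite ltnn.
apply/asboolP; eexists; apply: (invariant_family_add famF' mD iD D0) => i im.
by apply: contrapT => /eqP/set0P h; apply: H; exists i.
Qed.

Lemma conditional_probability C : measurable C -> 0 < pr mu C ->
  exists nu : probability X R, forall B, measurable B ->
    nu B = (mu (B `&` C) / mu C)%E.
Proof.
(* The last argument of [mnormalize] is a fallback for mass 0 or infinity, both excluded here. *)
move=> mC C0; exists (mnormalize (mrestr mu mC) mu) => B mB.
have ev : mrestr mu mC setT = mu C by rewrite /mrestr setTI.
transitivity ((if (mu C == 0) || (mu C == +oo) then fun U => mu U
    else fun U => mu (U `&` C) * (fine (mu C))^-1%:E)%E B); first by rewrite -ev.
rewrite ifF; last by rewrite (prE mu mC) eqe gt_eqF.
by rewrite {2}(prE mu mC) inver gt_eqF.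
Qed.

(** A maximal disjoint family of invariant sets of positive measure consists of atoms and covers [X]
    up to a null set; ergodicity of [T] makes the atoms equal in measure. *)
Lemma ergodic_decomposition_exists :
  exists m (nus : 'I_m -> probability X R), ergodic_decomposition mu T k nus.
Proof.
have [m [F [[mF dF] maxF]]] := maximal_invariant_family.
have mFi i : (i < m)%N -> measurable (F i) by move=> /mF[].
have iFi i : (i < m)%N -> invariant_set (act_pow T k) (F i) by move=> /mF[].
have F0 i : (i < m)%N -> 0 < pr mu (F i) by move=> /mF[].
have splitI A B : measurable A -> measurable B ->
    pr mu A = pr mu (A `&` B) + pr mu (A `\` B).
  move=> mA mB; rewrite -prU.
  - by rewrite setUIDK.
  - exact: measurableI.
  - exact: measurableD.
  - by rewrite setDE setIACA setICr setI0.
(* If [B] cut [F i] into two parts of positive measure, replacing [F i] by its part in [B] would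
   leave room for a further member. *)
have atom i B : (i < m)%N -> measurable B -> invariant_set (act_pow T k) B ->
    0 < pr mu (F i `&` B) -> pr mu (F i `\` B) = 0.
  move=> im mB iB FB0; apply/eqP; rewrite eq_le pr_ge0 andbT leNgt; apply/negP => FD0.
  pose F' j := if j == i then F i `&` B else F j.
  have F'F j : F' j `<=` F j.
    by rewrite /F'; case: eqP => [->|_]; [exact: subIsetl|exact: subset_refl].
  have famF' : invariant_family m F'.
    split=> [j jm|j l jm lm jl].
      rewrite /F'; case: eqP => [_|_]; last exact: mF.
      by split=> //; [apply: measurableI => //; exact: mFi|apply: invariant_setI => //; exact: iFi].
    rewrite -subset0 -(dF j l jm lm jl).
    by apply: setISS; exact: F'F.
  have [||j jm [x [F'x [Fx nBx]]]] := maxF _ _ _ FD0 _ famF'.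
  - by apply: measurableD => //; exact: mFi.
  - by apply: invariant_setD => //; exact: iFi.
  move: F'x; rewrite /F'; case: eqP => [_ [_ Bx]//|/eqP ji Fjx].
  by have : (F j `&` F i) x by []; rewrite dF.
have [mU prU] := pr_bigsetU mFi dF.
set U := \big[setU/set0]_(i < m) F i in mU prU *.
have CU0 : pr mu (~` U) = 0.
  apply/eqP; rewrite eq_le pr_ge0 andbT leNgt; apply/negP => U0.
  have iU : invariant_set (act_pow T k) U.
    move=> n; rewrite /U -bigcup_mkord preimage_bigcup.
    by apply: eq_bigcupr => i /= im; exact: iFi.
  have [||i im [x [Fx]]] := maxF _ _ _ U0 _ (conj mF dF).
  - exact: measurableC.
  - exact: invariant_setC.
  by case; rewrite /U -bigcup_mkord; exists i.
have totU B : measurable B -> pr mu B = \sum_(i < m) pr mu (B `&` F i).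
  move=> mB; rewrite (splitI B U mB mU).
  have -> : pr mu (B `\` U) = 0.
    apply/eqP; rewrite eq_le pr_ge0 -CU0 andbT.
    by apply: pr_le; [exact: measurableD|exact: measurableC|move=> x []].
  rewrite addr0 /U -bigcup_mkord setI_bigcupr bigcup_mkord.
  apply: (pr_bigsetU (F := fun i => B `&` F i) _ _).2 => [i im|i j im jm ij].
    by apply: measurableI => //; exact: mFi.
  by rewrite setIACA dF// setI0.
(* Some translate of [F i] meets the atom [F j] in positive measure, and so contains it up to a null
   set. *)
have le_eq i j : (i < m)%N -> (j < m)%N -> pr mu (F j) <= pr mu (F i).
  move=> im jm.
  have [[f fj]|H] := pselect (exists f, 0 < pr mu (F j `&` T (coset_rep f) @^-1` F i)).
    set B := T _ @^-1` F i in fj.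
    have mB : measurable B by exact: measurable_act mpT (mFi i im).
    have iB : invariant_set (act_pow T k) B.
      move=> n; rewrite /B -[in RHS](iFi i im n) /act_pow.
      by rewrite !(preimage_actD _ _ _ mpT) addrC.
    rewrite (splitI _ B)//; last exact: mFi.
    rewrite (atom j B)// addr0 -(pr_act (coset_rep f) mpT (mFi i im)).
    by apply: pr_le => //; apply: measurableI => //; exact: mFi.
  have := saturation_finite (mFi i im) (mFi j jm) (iFi i im) (F0 i im).
  rewrite big1 => [|f _]; first by rewrite leNgt F0.
  apply/eqP; rewrite eq_le pr_ge0 andbT leNgt; apply/negP => h.
  by apply: H; exists f.
have prF i : (i < m)%N -> pr mu (F i) = m%:R^-1.
  move=> im; have := totU setT measurableT; rewrite pr_setT.
  under eq_bigr do rewrite setTI.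
  rewrite (eq_bigr (fun=> pr mu (F i))) => [|j _]; last first.
    by apply/eqP; rewrite eq_le !le_eq.
  rewrite sumr_const card_ord => h; apply: (@mulIf _ m%:R).
    by rewrite pnatr_eq0 -lt0n; exact: leq_ltn_trans im.
  rewrite mulVf ?mulr_natr// pnatr_eq0 -lt0n; exact: leq_ltn_trans im.
have /choice[nus nusE] : forall i : 'I_m, exists nu : probability X R,
    forall B, measurable B -> nu B = (mu (B `&` F i) / mu (F i))%E.
  by move=> i; apply: conditional_probability; [exact: mFi|exact: F0].
have nuE (i : 'I_m) B : measurable B -> nus i B = (pr mu (B `&` F i) * m%:R)%:E.
  move=> mB; rewrite nusE// (prE mu (mFi i (ltn_ord i))) inver gt_eqF ?F0//.
  rewrite prF// invrK (prE mu (A := B `&` F i))//.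
  by apply: measurableI => //; exact: mFi.
have m_gt0 (i : 'I_m) : 0 < m%:R :> R by rewrite ltr0n; exact: leq_ltn_trans (ltn_ord i).
have [grT mT pT] := act_pow_preserving.
exists m, nus; split.
- move=> i; split.
    split=> // n B mB; rewrite !nuE//; last exact: measurable_act act_pow_preserving mB.
    rewrite -{1}(iFi i (ltn_ord i) n) -preimage_setI (pr_act n act_pow_preserving)//.
    by apply: measurableI => //; exact: mFi.
  move=> C mC iC; rewrite !nuE// setIC.
  have := pr_ge0 mu (F i `&` C); rewrite le_eqVlt => /orP[/eqP <-|FC0].
    by left; rewrite mul0r.
  right; have := splitI _ C (mFi i (ltn_ord i)) mC.
  rewrite (atom i C)// addr0 prF// => <-.
  by rewrite mulVf// gt_eqF// (m_gt0 i).
- move=> B mB; rewrite prE// totU//.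
  under [in RHS]eq_bigr do rewrite nuE//.
  rewrite sumEFin -EFinM mulr_sumr; congr (_%:E); apply: eq_bigr => i _.
  by rewrite mulrCA mulVf ?mulr1// gt_eqF// (m_gt0 i).
- exists (fun i => F i); split=> [|i].
    by apply/trivIsetP => i j _ _ ij; apply: dF.
  split; [exact: mFi|exact: iFi| |exact: nusE].
  by rewrite prE ?lte_fin ?F0//; exact: mFi.
Qed.

End ErgodicDecomposition.

(** * Correlations and density increment *)

Section Correlations.
Context (disp : measure_display) (X : measurableType disp) (R : realType) (d : nat).
Context (nu : probability X R) (T : 'rV[int]_d -> X -> X).
Context (mpT : measure_preserving_action nu T).
Context (A : set X) (mA : measurable A).

(** The set [B] is kept free because the mean of [overlap] is later studied as an additive function
    of [B]. *)
Definition overlap (B : set X) (x : 'rV[int]_d) : R := pr nu (B `&` T x @^-1` A).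

Definition correlation (x : 'rV[int]_d) : R := overlap A x - pr nu A ^+ 2.

Let mT x : measurable (T x @^-1` A).
Proof. exact: measurable_act mpT mA. Qed.

Lemma overlap_ge0 B x : 0 <= overlap B x.
Proof. exact: pr_ge0. Qed.

Lemma overlap_le B x : measurable B -> overlap B x <= pr nu B.
Proof. by move=> mB; apply: pr_le => //; exact: measurableI. Qed.

Lemma overlap_bdd B : measurable B -> bdd (overlap B).
Proof.
by move=> mB; exists (pr nu B) => x; rewrite ger0_norm ?overlap_ge0// overlap_le.
Qed.

Lemma overlapU B C x : measurable B -> measurable C -> B `&` C = set0 ->
  overlap (B `|` C) x = overlap B x + overlap C x.
Proof.
move=> mB mC BC; rewrite /overlap setIUl prU//; try exact: measurableI.
by rewrite setIACA BC set0I.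
Qed.

Lemma overlap_act B y x : measurable B -> overlap (T y @^-1` B) (x + y) = overlap B x.
Proof.
move=> mB; rewrite /overlap addrC -(preimage_actD _ _ _ mpT) -preimage_setI.
by rewrite (pr_act _ mpT)//; exact: measurableI.
Qed.

Lemma pr_preimageI x y : pr nu (T x @^-1` A `&` T y @^-1` A) = overlap A (y - x).
Proof. by rewrite -(overlap_act x (y - x))// subrK. Qed.

Lemma overlapN x : overlap A (- x) = overlap A x.
Proof.
by rewrite -[- x]sub0r -pr_preimageI (preimage_act0 _ mpT) setIC.
Qed.

(** The form at [s] is the squared L2 norm of the combination of centred indicators of translates of
    [A]; the constants are carried by [setT] with weight [- (a * c)]. *)
Lemma correlation_posdef : posdef correlation.
Proof.
split=> [x|s]; first by rewrite /correlation overlapN.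
pose a := pr nu A.
pose s1 : seq (R * set X) := [seq (p.1, T p.2 @^-1` A) | p <- s].
pose c : R := \sum_(p <- s) p.1.
have : 0 <= wform (fun A B => pr nu (A `&` B))
    (s1 ++ [:: (- (a * c), setT)]) (s1 ++ [:: (- (a * c), setT)]).
  apply: inter_posdef => p; rewrite mem_cat inE => /orP[/mapP[q _ ->]|/eqP ->].
    exact: mT.
  exact: measurableT.
rewrite wform_catl !wform_catr.
have -> : wform (fun A B => pr nu (A `&` B)) s1 s1 = form correlation s s + a ^+ 2 * c ^+ 2.
  rewrite /form /wform [c ^+ 2]expr2 {1}/c mulr_suml mulr_sumr -big_split big_map.
  apply: eq_bigr => p _ /=; rewrite big_map /c mulr_sumr mulr_sumr -big_split.
  apply: eq_bigr => q _ /=; rewrite pr_preimageI -overlapN opprB /correlation -/a.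
  ring.
have sT : wform (fun A B => pr nu (A `&` B)) s1 [:: (- (a * c), setT)] = - (a * c) * (a * c).
  rewrite [RHS](_ : _ = \sum_(p <- s) p.1 * (- (a * c) * a)); last first.
    by rewrite -mulr_suml -/c; ring.
  rewrite /wform big_map; apply: eq_bigr => p _.
  by rewrite big_seq1/= setIT (pr_act _ mpT)// -/a; ring.
rewrite [X in _ + (X + _)]wform_sym => [|C D]; last by rewrite setIC.
rewrite sT /wform !big_seq1/= setIT pr_setT.
by congr (_ <= _); ring.
Qed.

Lemma correlation_le1 : correlation 0 <= 1.
Proof.
rewrite /correlation lerBlDr (le_trans (overlap_le _ _))//.
by rewrite (le_trans (pr_le1 _ _))// lerDl sqr_ge0.
Qed.

(* [|| avg 1_{E i} - a + a 1_C ||^2 >= 0], the mean [avg] being over [i]. *)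
Lemma pr_avoid (I : eqType) (S : seq I) (E : I -> set X) (C : set X) (a : R) :
  (0 < size S)%N -> (forall i, measurable (E i)) -> measurable C ->
  (forall i, pr nu (E i) = a) -> (forall i, pr nu (E i `&` C) = 0) ->
  a ^+ 2 * pr nu C <= avg S (fun i => avg S (fun j => pr nu (E i `&` E j) - a ^+ 2)).
Proof.
move=> S0 mE mC Ea EC.
pose s1 : seq (R * set X) := [seq ((size S)%:R^-1, E i) | i <- S].
pose s2 : seq (R * set X) := [:: (- a, setT); (a, C)].
have : 0 <= wform (fun A B => pr nu (A `&` B)) (s1 ++ s2) (s1 ++ s2).
  apply: inter_posdef => p; rewrite mem_cat !inE => /orP[/mapP[i _ ->]|/orP[/eqP ->|/eqP ->]]; first exact: mE.
    exact: measurableT.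
  exact: mC.
rewrite wform_catl !wform_catr.
have -> : wform (fun A B => pr nu (A `&` B)) s1 s1 =
    avg S (fun i => avg S (fun j => pr nu (E i `&` E j))).
  rewrite /wform big_map /avg mulr_suml; apply: eq_bigr => i _.
  rewrite big_map mulrC mulr_suml mulr_sumr; apply: eq_bigr => j _ /=.
  by rewrite -mulrA; congr (_ * _); rewrite mulrC.
have s12 : wform (fun A B => pr nu (A `&` B)) s1 s2 = - a ^+ 2.
  transitivity (avg S (fun=> - a ^+ 2)); last by rewrite avg_cst.
  rewrite /wform big_map /avg mulr_suml; apply: eq_bigr => i _.
  rewrite big_cons big_seq1/= setIT EC Ea; ring.
rewrite [X in _ + (X + _)]wform_sym => [|? ?]; last by rewrite setIC.
rewrite s12 /wform !big_cons !big_nil/= !setIT setTI setIid pr_setT.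
set V := avg S _ => h.
have -> : avg S (fun i => avg S (fun j => pr nu (E i `&` E j) - a ^+ 2)) = V - a ^+ 2.
  rewrite -[in RHS](avg_cst (a ^+ 2) S0) -[- avg S _]mulN1r -avgZ -avgD.
  apply: eq_avg => i; rewrite -[in RHS](avg_cst (a ^+ 2) S0) -avgZ -avgD.
  by apply: eq_avg => j; rewrite mulN1r.
by rewrite -subr_ge0; move: h; congr (_ <= _); ring.
Qed.

End Correlations.

(** * Comparing components of different powers of the action *)

Section Components.
Context (disp : measure_display) (X : measurableType disp) (R : realType) (d : nat).
Context (mu : probability X R) (T : 'rV[int]_d -> X -> X) (ergT : ergodic_action mu T).
Implicit Types (A B C : set X).

Let mpT : measure_preserving_action mu T := ergT.1.

Lemma act_powM k l : act_pow (act_pow T k) l = act_pow T (k * l).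
Proof. by apply/funext => n; rewrite /act_pow -mulrnA mulnC. Qed.

Lemma decomposition_pr k m (nus : 'I_m -> probability X R) B :
  ergodic_decomposition mu T k nus -> measurable B ->
  pr mu B = m%:R^-1 * \sum_(i < m) pr (nus i) B.
Proof.
move=> [_ + _] mB => /(_ B mB).
rewrite prE//; under eq_bigr do rewrite prE//.
by rewrite sumEFin -EFinM => -[].
Qed.

Lemma ergodic_component_ge k A : (0 < k)%N -> measurable A ->
  exists nu, ergodic_component mu T k nu /\ pr mu A <= pr nu A.
Proof.
move=> k0 mA; have [m [nus dec]] := ergodic_decomposition_exists ergT k0.
apply: contrapT => H.
have lt i : pr (nus i) A < pr mu A.
  rewrite ltNge; apply/negP => h; apply: H; exists (nus i); split=> //.
  by exists m, nus, i.
have m0 : (0 < m)%N.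
  rewrite lt0n; apply/eqP => m0; have := decomposition_pr dec measurableT.
  rewrite pr_setT (_ : m%:R^-1 = 0 :> R) ?m0 ?invr0// mul0r => /eqP.
  by rewrite oner_eq0.
suff : pr mu A < pr mu A by rewrite ltxx.
rewrite {1}(decomposition_pr dec mA) mulrC ltr_pdivrMr ?ltr0n//.
rewrite mulr_natr -[m in ltRHS]card_ord -sumr_const.
apply: ltr_sum => [|i _]; last exact: lt.
by apply/hasP; exists (Ordinal m0) => //; rewrite mem_index_enum.
Qed.

Lemma projs_sum_invariant (G : zmodType) (phi : G -> R) (ws : seq G) (z : nat -> int) :
  bdd phi -> invariant (\sum_(0 <= i < size ws) ws`_i *~ z i) (projs ws phi).
Proof.
move=> bp; rewrite big_mkord; elim/big_ind: _ => [|v w iv iw|i _].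
- exact: invariant0.
- exact: invariantD.
- apply: invariantMz; apply: projs_invariant => //; exact: mem_nth.
Qed.

Lemma additive_sum (lam : set X -> R) (m : nat) (D : 'I_m -> set X) :
  (forall A B, measurable A -> measurable B -> A `&` B = set0 ->
    lam (A `|` B) = lam A + lam B) ->
  (forall i, measurable (D i)) -> trivIset setT D ->
  (forall B, measurable B -> B `&` \big[setU/set0]_i D i = set0 -> lam B = 0) ->
  forall B, measurable B -> lam B = \sum_i lam (B `&` D i).
Proof.
move=> lamU mD tD lam0 B mB.
have H (s : seq 'I_m) : uniq s ->
    lam (B `&` \big[setU/set0]_(i <- s) D i) = \sum_(i <- s) lam (B `&` D i).
  elim: s => [_|i s IH /= /andP[nis us]].
    by rewrite !big_nil setI0 lam0// set0I.
  have mU : measurable (\big[setU/set0]_(i <- s) D i) by exact: bigsetU_measurable.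
  have DU : D i `&` \big[setU/set0]_(j <- s) D j = set0.
    rewrite -bigcup_seq setI_bigcupr; apply: bigcup0 => j /= js.
    move/trivIsetP : tD => /(_ i j Logic.I Logic.I); apply.
    by apply: contraNneq nis => ->.
  rewrite !big_cons setIUr lamU ?IH//; [exact: measurableI|exact: measurableI|].
  by rewrite setIACA DU setI0.
have mU : measurable (\big[setU/set0]_i D i) by exact: bigsetU_measurable.
rewrite -H ?index_enum_uniq// -[in LHS](setUIDK B (\big[setU/set0]_i D i)) lamU.
- rewrite [X in _ + X]lam0 ?addr0//; first exact: measurableD.
  by rewrite setDE -setIA setICl setI0.
- exact: measurableI.
- exact: measurableD.
- by rewrite setDE setIACA setICr setI0.
Qed.

(* [ws] spans a finite-index subgroup, so that averaging over it gives a measure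
   which is invariant under [K Z^d] and thus a multiple of each component of [T^K]. *)
Lemma component_projs_le k M nu A (ws : seq 'rV[int]_d) (eta : R) :
  (0 < k * M)%N -> ergodic_component mu T k nu -> measurable A ->
  (forall nu', ergodic_component mu T (k * M) nu' -> pr nu' A <= pr nu A + eta) ->
  (forall g : 'rV[int]_d, exists z : nat -> int,
     g *~ M = \sum_(0 <= i < size ws) ws`_i *~ z i) ->
  projs ws (overlap nu (act_pow T k) A A) 0 <= (pr nu A + eta) * pr nu A.
Proof.
move=> kM [m [nus [i [[erg dec [C [tC HC]]] ->]]]] mA sup span.
set nu' := nus i in sup *.
have erg' : ergodic_action nu' (act_pow T k) := erg i.
have mp' := erg'.1.
have [mC iC C0 nuC] := HC i.
have C0' : 0 < pr mu (C i) by rewrite -lte_fin -prE.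
have prnu B : measurable B -> pr nu' B = pr mu (B `&` C i) / pr mu (C i).
  move=> mB; apply: EFin_inj; rewrite -prE// nuC// (prE mu mC) inver gt_eqF//.
  by rewrite EFinM (prE mu (A := B `&` C i))//; exact: measurableI.
pose lam B := projs ws (overlap nu' (act_pow T k) A B) 0.
have bo B : measurable B -> bdd (overlap nu' (act_pow T k) A B).
  by move=> mB; exact: overlap_bdd.
have lamU A' B : measurable A' -> measurable B -> A' `&` B = set0 ->
    lam (A' `|` B) = lam A' + lam B.
  move=> mA' mB AB; rewrite /lam -projsD; [|exact: bo|exact: bo].
  by congr (projs ws _ 0); apply/funext => x; exact: overlapU.
have lam_ge0 B : measurable B -> 0 <= lam B.
  move=> mB; rewrite /lam -[leLHS](projs_cst ws 0 0); apply: le_projs; [exact: bdd_cst|exact: bo|].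
  by move=> x; exact: overlap_ge0.
have lam_le B : measurable B -> lam B <= pr nu' B.
  move=> mB; rewrite /lam -[leRHS](projs_cst ws _ 0); apply: le_projs; [exact: bo|exact: bdd_cst|].
  by move=> x; exact: overlap_le.
have lamT : lam setT = pr nu' A.
  rewrite /lam -[RHS](projs_cst ws _ 0); congr (projs ws _ 0); apply/funext => x.
  by rewrite /overlap setTI (pr_act _ mp').
(* Translating [B] by [n *+ M] shifts the overlap function by a vector in the span of [ws], under
   which the mean is invariant. *)
have lam_act n B : measurable B -> lam (act_pow T (k * M) n @^-1` B) = lam B.
  move=> mB; rewrite -act_powM /lam.
  have [z Mz] := span n.
  have inv : invariant (n *+ M) (projs ws (overlap nu' (act_pow T k) A
      (act_pow (act_pow T k) M n @^-1` B))).
    rewrite pmulrn Mz; apply: projs_sum_invariant; apply: bo.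
    exact: measurable_act mp' mB.
  rewrite -[LHS]inv projs_translate; congr (projs ws _ 0); apply/funext => x.
  exact: overlap_act.
have [m' [nus' dec']] := ergodic_decomposition_exists ergT kM.
have sup' l : pr (nus' l) A <= pr nu' A + eta by apply: sup; exists m', nus', l.
have [erg2 _ [D [tD HD]]] := dec'.
have mD l : measurable (D l) by have [] := HD l.
have prnu2 l B : measurable B -> pr mu (B `&` D l) = pr (nus' l) B * pr mu (D l).
  move=> mB; have [_ _ D0 nuD] := HD l.
  have D0' : 0 < pr mu (D l) by rewrite -lte_fin -prE.
  suff -> : pr (nus' l) B = pr mu (B `&` D l) / pr mu (D l) by rewrite divfK// gt_eqF.
  apply: EFin_inj; rewrite -prE// nuD// (prE mu (mD l)) inver gt_eqF//.
  by rewrite EFinM (prE mu (A := B `&` D l))//; exact: measurableI.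
(* A set missing every [D l] is null for all components of [T^(k M)], hence for [mu], [nu'] and
   [lam]. *)
have lam0 B : measurable B -> B `&` \big[setU/set0]_l D l = set0 -> lam B = 0.
  move=> mB BD; apply/eqP; rewrite eq_le lam_ge0// andbT (le_trans (lam_le _ mB))//.
  rewrite prnu// ler_pdivrMr// mul0r.
  apply: (@le_trans _ _ (pr mu B)); first by apply: pr_le => //; exact: measurableI.
  rewrite (decomposition_pr dec' mB) big1 ?mulr0// => l _.
  have [_ _ D0 _] := HD l.
  have D0' : 0 < pr mu (D l) by rewrite -lte_fin -prE.
  have := prnu2 l B mB; rewrite (_ : B `&` D l = set0).
    by rewrite pr0 => /esym/eqP; rewrite mulf_eq0 (gt_eqF D0') orbF => /eqP.
  rewrite -subset0 -BD; apply: setIS; rewrite (bigD1 l)//=; exact: subsetUl.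
(* Restricted to [D l], [lam] is invariant and dominated by a multiple of [nus' l], so it is
   proportional to it. *)
have lamD l : lam (A `&` D l) = lam (D l) * pr (nus' l) A.
  have := @ergodic_unique _ _ _ _ (nus' l) (act_pow T (k * M)) (fun B => lam (B `&` D l))
    (pr mu (D l) / pr mu (C i)) (erg2 l) _ _ _ A mA.
  rewrite setTI; apply.
  - move=> A' B mA' mB AB; rewrite setIUl lamU//; try exact: measurableI.
    by rewrite setIACA AB set0I.
  - move=> B mB; have mBD : measurable (B `&` D l) by exact: measurableI.
    rewrite lam_ge0//= (le_trans (lam_le _ mBD))// prnu//.
    rewrite mulrAC [_ * pr (nus' l) B]mulrC -prnu2// ler_pM2r ?invr_gt0//.
    by apply: pr_le => //; exact: measurableI.
  - move=> n B mB; have [_ iD _ _] := HD l.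
    by rewrite -{1}(iD n) -preimage_setI lam_act//; exact: measurableI.
(* Each [pr (nus' l) A] is at most [pr nu' A + eta], and the masses [lam (D l)] add up to
   [lam setT], which is [pr nu' A]. *)
rewrite -/(lam A) (additive_sum lamU mD tD lam0 mA) -[X in _ <= _ * X]lamT.
rewrite (additive_sum lamU mD tD lam0 measurableT) mulr_sumr.
by apply: ler_sum => l _; rewrite lamD setTI mulrC ler_wpM2r// lam_ge0.
Qed.

End Components.

(** * Choice of constants and conclusion *)

Theorem theorem1p3 (R : realType) (r d : nat) (r_gt0 : (0 < r)%N)
  (d_gt0 : (0 < d)%N) (P : 'I_d -> mpoly r int)
  (P0 : zero_constant_term P) (Pfree : linearly_independent R P)
  (delta eps : R) (delta_gt0 : 0 < delta) (eps_gt0 : 0 < eps) :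
  exists k0 : nat, (0 < k0)%N /\
    forall (disp : measure_display) (X : measurableType disp)
      (mu : probability X R) (T : 'rV[int]_d -> X -> X),
      ergodic_action mu T ->
      forall A : set X, measurable A -> (delta%:E <= mu A)%E ->
        exists (k : nat) (nu : probability X R),
          [/\ (0 < k)%N, (k <= k0)%N, ergodic_component mu T k nu,
              (mu A <= nu A)%E &
              ((1 - eps)%:E <
                 nu (\bigcup_(n in [set: 'rV[int]_r]) (T (poly_eval P n) @` A)))%E].
Proof.
have [vs [c [c_gt0 evalP span]]] := kronecker_curve P0 Pfree.
pose D := size vs.
(* The complement of the union will have measure at most [2 * e / a ^+ 2] with [a >= delta], that
   is, at most [eps / 2]. *)
pose e := eps * delta ^+ 2 / 4.
have e_gt0 : 0 < e by rewrite divr_gt0// mulr_gt0// exprn_gt0.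
have e1_gt0 : 0 < e / D.+1%:R by rewrite divr_gt0.
have [Q [Q_gt0 HQ]] := curve_energy D e1_gt0 (isT : 0 < 1)%N.
(* The ratio of successive terms is the [M] of [component_projs_le]: [Q] comes from the energy
   bound, [c] from the span of [vs], [k ^ D] from rescaling the curve. *)
pose kk j := iter j (fun k => k * (Q * c * k ^ D))%N 1%N.
have kk_gt0 j : (0 < kk j)%N.
  by elim: j => //= j IH; rewrite !muln_gt0 IH Q_gt0 c_gt0 expn_gt0 IH.
pose n := (Num.truncn e^-1).+1.
have ne : 1 < n%:R * e by rewrite -ltr_pdivrMr// div1r truncnS_gt.
exists (\prod_(j < n) kk j)%N; split; first by apply: prodn_gt0 => j; exact: kk_gt0.
move=> disp X mu T ergT A mA deltaA.
have mpT := ergT.1.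
have muA : delta <= pr mu A by rewrite -lee_fin -prE.
(* Density increment: gaining more than [e] at each of [n] steps would bring the measure of [A]
   above 1. *)
have [j [nu [jn comp nuA sup]]] : exists j nu, [/\ (j < n)%N,
    ergodic_component mu T (kk j) nu, pr mu A <= pr nu A &
    forall nu', ergodic_component mu T (kk j.+1) nu' -> pr nu' A <= pr nu A + e].
  apply: contrapT => H.
  have chain j : (j <= n)%N ->
      exists nu, ergodic_component mu T (kk j) nu /\ pr mu A + j%:R * e <= pr nu A.
    elim: j => [_|j IH jn].
      have [nu [comp h]] := ergodic_component_ge ergT (kk_gt0 0%N) mA.
      by exists nu; rewrite mul0r addr0.
    have [nu [comp h]] := IH (ltnW jn).
    have [nu' [comp' h']] : exists nu', ergodic_component mu T (kk j.+1) nu' /\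
        pr nu A + e < pr nu' A.
      apply: contrapT => H'; apply: H; exists j, nu; split=> //.
        by rewrite (le_trans _ h)// lerDl mulr_ge0// ltW.
      by move=> nu' comp'; rewrite leNgt; apply/negP => h'; apply: H'; exists nu'.
    exists nu'; split=> //; rewrite (le_trans _ (ltW h'))//.
    by rewrite -natr1 mulrDl mul1r addrA lerD2r.
  have [nu [_ h]] := chain n (leqnn n).
  by have := pr_le1 nu mA; have := pr_ge0 mu A; lra.
set k := kk j in comp sup.
have k_gt0 : (0 < k)%N := kk_gt0 j.
exists k, nu; split=> //.
- exact: dvdn_leq (prodn_gt0 _) (dvdn_prod_iota kk jn).
- by rewrite !prE// lee_fin.
have erg : ergodic_action nu (act_pow T k).
  by have [m [nus [i [[erg _ _] ->]]]] := comp; exact: erg.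
have mp := erg.1.
pose a := pr nu A.
have a_ge : delta <= a by exact: le_trans nuA.
(* At time [k t] the curve is [k] times the curve with coefficients [k^i v_i]; the factor [k] is
   absorbed by passing from [T] to [T^k]. *)
pose ws := [seq vs`_i *~ (k ^ i)%N | i <- iota 0 D].
have szws : size ws = D by rewrite size_map size_iota.
have nthws i : (i < D)%N -> ws`_i = vs`_i *~ (k ^ i)%N.
  by move=> iD; rewrite (nth_map 0%N) ?size_iota// nth_iota.
pose phi := correlation nu (act_pow T k) A.
have pd : posdef phi by exact: correlation_posdef.
have [S [S0 _ HS]] := HQ _ phi ws szws pd (correlation_le1 mp mA).
have projs_phi : projs [seq v *~ Q | v <- ws] phi 0 <= e.
  have bo : bdd (overlap nu (act_pow T k) A A) by exact: overlap_bdd.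
  rewrite [leLHS](_ : _ = projs [seq v *~ Q | v <- ws] (overlap nu (act_pow T k) A A) 0
      + - a ^+ 2); last first.
    rewrite -[in RHS](projs_cst [seq v *~ Q | v <- ws] (- a ^+ 2) 0).
    by rewrite -projsD//; exact: bdd_cst.
  have := @component_projs_le _ _ _ _ _ _ ergT k (Q * c * k ^ D)%N nu A
    [seq v *~ Q | v <- ws] e (kk_gt0 j.+1) comp mA sup.
  rewrite -/a => h; rewrite lerBlDr (le_trans (h _))//.
    move=> g; have [z zE] := span g.
    (* The factor [k ^ (D - i)] completes the [k ^ i] in the [i]-th vector to the common [k ^ D]. *)
    exists (fun i => z i * (k ^ (D - i))%N); rewrite size_map szws.
    rewrite -mulnA mulnCA PoszM mulrzA zE mulrz_suml.
    rewrite big_nat [RHS]big_nat; apply: eq_bigr => i /andP[_ iD].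
    rewrite (nth_map 0) ?szws// nthws// -!mulrzA; congr (_ *~ _).
    have -> : (k ^ D = k ^ i * k ^ (D - i))%N by rewrite -expnD subnKC// ltnW.
    by rewrite !PoszM; ring.
  by rewrite mulrDl addrC -expr2 lerD2r ler_piMr// ?pr_le1// ltW.
pose U := \bigcup_(n in [set: 'rV[int]_r]) (T (poly_eval P n) @` A).
have mU : measurable U.
  apply: countable_bigcupT_measurable => [|m]; first exact: countableP.
  by rewrite (image_act _ _ mpT); exact: measurable_act mpT mA.
have mCU : measurable (~` U) by exact: measurableC.
(* The sign is there because the image of [A] under [T^p] is its preimage under [T^(-p)]. *)
pose E t := act_pow T k (- curve ws t) @^-1` A.
have mE t : measurable (E t) by exact: measurable_act mp mA.
have EU t : E t `<=` U.
  have [m mE'] := evalP (k%:Z * t).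
  move=> x Ex; exists m => //; rewrite (image_act _ _ mpT) mE'.
  suff -> : curve vs (k%:Z * t) = curve ws t *+ k by rewrite -mulNrn.
  rewrite pmulrn /curve szws mulrz_suml big_nat [RHS]big_nat.
  apply: eq_bigr => i /andP[_ iD]; rewrite nthws// -!mulrzA; congr (_ *~ _).
  have -> : (k ^ i)%N%:Z = k%:Z ^+ i by rewrite -natz natrX natz.
  by rewrite exprMn [k%:Z ^+ i.+1]exprS; ring.
have avoid : a ^+ 2 * pr nu (~` U) <= e + e.
  have := @pr_avoid _ _ _ nu _ S E (~` U) a S0 mE mCU _ _.
  move=> /(_ _ _) h; apply: le_trans (h _ _) _.
  - by move=> t; rewrite (pr_act _ mp).
  - move=> t; rewrite (_ : _ `&` _ = set0) ?pr0//.
    by rewrite -subset0 => x [/EU].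
  (* The energy bound contributes [D * (e / D.+1) <= e], and the mean over the subgroup another
     [e]. *)
  apply: le_trans (le_trans (HS 0) _); last first.
    rewrite lerD// mulrA ler_pdivrMr// mulrC ler_wpM2l ?ler_nat//.
    exact: ltW.
  rewrite le_eqVlt; apply/orP; left; apply/eqP.
  apply: eq_avg => t; apply: eq_avg => t'; rewrite !add0r.
  rewrite (pr_preimageI mp mA) /phi /correlation; congr (overlap _ _ _ _ _ - _).
  by rewrite opprK addrC.
rewrite prE// lte_fin.
have -> : pr nu U = 1 - pr nu (~` U).
  have := prU nu mU mCU (setICr U); rewrite setUCr pr_setT; lra.
rewrite ltrD2l ltrN2.
have : delta ^+ 2 * pr nu (~` U) <= eps * delta ^+ 2 / 2.
  rewrite (le_trans _ (le_trans avoid _))//.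
    by rewrite ler_wpM2r ?pr_ge0// ler_sqr ?nnegrE// ?(le_trans _ a_ge)// ltW.
  by rewrite /e; lra.
have d2 : 0 < delta ^+ 2 by rewrite exprn_gt0.
rewrite (_ : eps * _ / 2 = delta ^+ 2 * (eps / 2)); last by field.
by rewrite ler_pM2l// => h; lra.
Qed.
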